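(* Let $\psi:\mathbb{N}\to[0,\infty)$ be any function such that $S_\psi:=\sum_{q=1}^{\infty}\psi(q)^2$ converges. Assume additionally that $\psi(q)=0$ for all $q\leq\exp(\exp(41))$. Let $\delta>0$ and let $\kappa=\kappa(\delta)$ be a real number with $$\kappa<\min\left\{\frac{1}{6\max_{n\in\mathbb{N}}\psi(n)},\ \frac{\delta}{\sqrt{S_\psi}}\cdot\frac{2}{3\pi^2\sqrt{\frac{\pi^2}{6}\zeta\left(\frac{112}{57}\right)}},\ \sqrt{\frac{\delta}{S_\psi}}\sqrt{\frac{1}{18\pi^2}},\ \left(\frac{\delta}{S_\psi}\right)^{\frac23}\left(2\pi^2\sqrt{12}\left(4.19253564643679+27\cdot 4^{\frac{3}{16}+\frac{5}{2\cdot57}+\frac{\frac{41}{e^{41}}+\left(\frac{41}{e^{41}}\right)^2}{2}}\right)\right)^{-\frac23}\right\}.$$ Then $$\lambda\left(\mathcal{B}'(\psi,\kappa)\right)\geq 1-\delta .$$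
   Context: $\mathbb{N}=\{1,2,3,\dots\}$; $\lambda$ is Lebesgue measure on $\mathbb{R}$; $\lVert y\rVert$ denotes the distance from the real number $y$ to the nearest integer; $\zeta$ is the Riemann zeta function. For $\psi:\mathbb{N}\to[0,\infty)$ and real $\kappa$, $$\mathcal{B}'(\psi,\kappa):=\left\{x\in[0,1]:\ \max\left(\lVert qx\rVert,\lVert qx^2\rVert\right)>\kappa\,\psi(q)\ \text{ for all } q\in\mathbb{N}\right\}.$$ No monotonicity of $\psi$ is assumed. If $\psi$ is identically zero, quotients with zero denominator are read as $+\infty$. *)

(* Defs.v *)
(* MathComp-Analysis; real numbers are the elements of an arbitrary
   R : realType. The positive integers are the q : nat with (0 < q)%N: the
   value at 0 of a function psi : nat -> R is never used. *)
From HB Require Import structures.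
From mathcomp Require Import all_boot all_order all_algebra.
From mathcomp Require Import all_classical all_reals all_analysis.
Set Implicit Arguments.
Unset Strict Implicit.
Unset Printing Implicit Defensive.
Import Order.TTheory GRing.Theory Num.Theory.
Import numFieldNormedType.Exports.
Local Open Scope classical_set_scope.
Local Open Scope ring_scope.

Definition sum_pos (R : realType) (a : nat -> R) : R :=
  limn (fun n => \sum_(1 <= q < n) a q).

(* Riemann zeta function at a real argument s; meaningful only for 1 < s, where
   the Dirichlet series converges. *)
Definition zeta (R : realType) (s : R) : R :=
  sum_pos (fun n => n%:R `^ (- s)).

Definition dist_int (R : realType) (y : R) : R :=
  inf [set `|y - m%:~R| | m in [set: int]].

Definition sum_sq (R : realType) (psi : nat -> R) : R :=
  sum_pos (fun q => psi q ^+ 2).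

(* If psi is nonnegative and sum_sq converges, this supremum is a maximum: see
   max_val_max below. *)
Definition max_val (R : realType) (psi : nat -> R) : R :=
  sup [set psi n | n in [set n : nat | (0 < n)%N]].

Definition Bad (R : realType) (psi : nat -> R) (kappa : R) : set R :=
  [set x | x \in `[0, 1] /\
    forall q : nat, (0 < q)%N ->
      kappa * psi q <
        Num.max (dist_int (q%:R * x)) (dist_int (q%:R * x ^+ 2))].

(* The decimal 4.19253564643679, split into blocks of four digits because
   integer literals denote unary natural numbers. *)
Definition c_dec (R : realType) : R :=
  4 + 1925 / 10 ^+ 4 + 3564 / 10 ^+ 8 + 6436 / 10 ^+ 12 + 79 / 10 ^+ 14.

Definition expo (R : realType) : R :=
  let t : R := 41 / expR 41 in
  3 / 16 + 5 / (2 * 57) + (t + t ^+ 2) / 2.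

(* The quotients by max_val psi and sum_sq psi are formed in \bar R, where the
   inverse of 0 is +oo; all the other factors are positive. *)
Definition kappa_bound (R : realType) (psi : nat -> R) (delta : R) : \bar R :=
  let S := sum_sq psi in
  (mine (1 / (6 * max_val psi)%:E)
  (mine (delta%:E / (Num.sqrt S)%:E *
           (2 / (3 * pi ^+ 2 * Num.sqrt (pi ^+ 2 / 6 * zeta (112 / 57))))%R%:E)
  (mine (sqrte (delta%:E / S%:E) * (Num.sqrt (1 / (18 * pi ^+ 2)))%R%:E)
        (poweR (delta%:E / S%:E) (2 / 3) *
           ((2 * pi ^+ 2 * Num.sqrt 12 * (c_dec R + 27 * 4 `^ expo R))
              `^ (- (2 / 3)))%R%:E))))%E.

Lemma max_val_max (R : realType) (psi : nat -> R) :
  (forall q : nat, (0 < q)%N -> 0 <= psi q) ->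
  cvgn (fun n => \sum_(1 <= q < n) psi q ^+ 2) ->
  (exists2 n : nat, (0 < n)%N & psi n = max_val psi) /\
  (forall n : nat, (0 < n)%N -> psi n <= max_val psi).
Proof.
move=> psi0 cv.
have cv0 : (fun n => psi n.+1 ^+ 2) @ \oo --> (0 : R).
  have cvS : cvgn (series (fun n => psi n.+1 ^+ 2)).
    have -> : series (fun n => psi n.+1 ^+ 2) =
              (fun n => \sum_(1 <= q < n.+1) psi q ^+ 2).
      by apply/funext => n; rewrite /series /= big_add1.
    by apply/cvg_ex; case/cvg_ex: cv => l cvl; exists l; move: cvl; rewrite -cvg_shiftS.
  exact: cvg_series_cvg_0.
set A := [set psi n | n in [set n : nat | (0 < n)%N]].
suff [m m0 mP] : exists2 m : nat, (0 < m)%N &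
    forall n : nat, (0 < n)%N -> psi n <= psi m.
  have ubm : ubound A (psi m) by move=> _ [n n0 <-]; exact: mP.
  have Am : A (psi m) by exists m.
  have eqm : psi m = max_val psi.
    apply/eqP; rewrite eq_le; apply/andP; split.
      by apply: ub_le_sup => //; exists (psi m).
    by apply: ge_sup => //; exists (psi m).
  by split; [exists m | move=> n n0; rewrite -eqm; exact: mP].
have [[k k0 psik]|] := pselect (exists2 k : nat, (0 < k)%N & psi k != 0); last first.
  move=> h; exists 1%N => // n n0; suff -> : psi n = 0 by apply: psi0.
  by apply/eqP/negP => /negP hn; apply: h; exists n.
have pk : 0 < psi k by rewrite lt_def psik psi0.
have : \forall n \near \oo, psi n.+1 ^+ 2 < psi k ^+ 2.
  by apply: (cvgr_lt _ cv0); rewrite exprn_gt0.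
case=> N _ hN.
pose i0 : 'I_(N.+1 + k).+1 := inord k.
have i0E : i0 = k :> nat by rewrite inordK // ltnS leq_addl.
have i0P : (0 < i0)%N by rewrite i0E.
have [i iP imax] := @arg_maxP _ _ _ i0 (fun i => (0 < i)%N) (fun i => psi i) i0P.
exists i => // n n0; have [nlt|nge] := ltnP n (N.+1 + k).+1.
  by have := imax (Ordinal nlt); apply.
have : psi k <= psi i by have := imax i0 i0P; rewrite i0E.
apply: le_trans; have := hN n.-1; rewrite /= prednK //.
have Nn : (N <= n.-1)%N by rewrite -ltnS prednK // (leq_trans _ nge) // ltnS (leq_trans (leqnSn N)) // leq_addr.
by move=> /(_ Nn) /ltW; rewrite ler_pXn2r // nnegrE psi0.
Qed.

(* Main.v *)
(** Write phi(q) = kappa psi(q) < 1/6. If x is in [0,1] and both ||qx|| and ||qx^2||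
    are at most phi(q), then x lies within phi(q)/q of some a/q, 0 <= a <= q, with
    ||a^2/q|| <= 3 phi(q). A Fejer kernel and the elementary bound
    |sum_a e(k a^2/q)|^2 <= q gcd(2k,q) show that there are O(phi q + sqrt (q tau(q)))
    such a, where tau is the divisor function.

    The error sqrt (q tau(q)) is slightly too large to be summed against phi(q)/q when
    only sum phi(q)^2 converges. If a prime p divides q exactly, however, a residue
    mod q/p together with the integer b = a^2 mod q leaves at most two choices for a,
    so that up to a factor 2 in the main term the modulus q may be replaced by q/p,
    which divides the error by sqrt p. Take for p the largest prime factor of q.
    When p is large, either p or (if p^2 divides q) the rarity of such q makes the
    squares of the errors summable: they are bounded by
    sum_p p^-2 (prod_{p' <= p} (1 - 1/p')^-1)^2, where a wheel mod 6 bounds the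
    product by a multiple of p^(1/3). When p is small, q is smooth and larger than
    exp (exp 41), and Rankin's trick applies. Cauchy-Schwarz then bounds the total
    measure by 48 pi kappa^2 S + kappa sqrt S, which the second and third upper bounds
    for kappa make at most delta. *)
Require Import Defs.
From HB Require Import structures.
From mathcomp Require Import all_boot all_order all_algebra.
From mathcomp Require Import all_classical all_reals all_analysis.
From mathcomp Require Import ring lra zify.
Set Implicit Arguments.
Unset Strict Implicit.
Unset Printing Implicit Defensive.
Import Order.TTheory GRing.Theory Num.Theory.
Import numFieldNormedType.Exports.
Local Open Scope classical_set_scope.
Local Open Scope ring_scope.

(** * Trigonometric facts *)

Lemma sin_le_id (R : realType) (x : R) : 0 <= x -> sin x <= x.
Proof.
move=> x0; have [c _] := @MVT_segment R sin cos 0 x x0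
  (fun y _ => is_derive_sin y)
  (@continuous_subspaceT _ _ _ _ (@continuous_sin R)).
rewrite sin0 !subr0 => ->; rewrite -[leRHS]mul1r ler_wpM2r //; exact: cos_le1.
Qed.

(** The triple-angle formula at pi/6 reads 1 = 3 s - 4 s^3 with s = sin (pi/6), that is (s + 1) (2 s
    - 1)^2 = 0. Hence s = 1/2, and sin x <= x gives 1/2 <= pi/6. *)
Lemma pi_ge3 (R : realType) : 3 <= pi :> R.
Proof.
set s : R := sin (pi / 6); set c : R := cos (pi / 6).
have cs : c ^+ 2 + s ^+ 2 = 1 by exact: cos2Dsin2.
have p0 := @pi_gt0 R.
have s0 : 0 < s by rewrite sin_gt0_pi //; apply/andP; split; lra.
have s3 : 1 = 3 * s - 4 * s ^+ 3.
  rewrite -[LHS]sin_pihalf (_ : pi / 2 = pi / 6 *+ 2 + pi / 6); last by field.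
  rewrite sinD sin_mulr2n cos_mulr2n -/s -/c.
  rewrite [LHS](_ : _ = s * (4 * c ^+ 2 - 1)); last by ring.
  by rewrite (_ : c ^+ 2 = 1 - s ^+ 2); [ring|rewrite -cs; ring].
have s2 : (s + 1) * (2 * s - 1) ^+ 2 = 0 
  by rewrite [LHS](_ : _ = 1 - (3 * s - 4 * s ^+ 3)); [rewrite -s3 subrr|ring].
have sE : s = 1 / 2.
  move/eqP: s2; rewrite mulf_eq0 => /orP[/eqP|]; first by lra.
  by rewrite sqrf_eq0 => /eqP; lra.
have := @sin_le_id R (pi / 6); rewrite -/s sE => /(_ _); lra.
Qed.

Lemma cos_ge_half (R : realType) (x : R) : `|x| <= 1 -> 1 / 2 <= cos x.
Proof.
rewrite -(cos_norm x); set y := `|x| => y1; have y0 : 0 <= y by exact: normr_ge0.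
rewrite (_ : y = (y / 2) *+ 2); last by field.
rewrite cos_mulr2n cos2sin2.
have s1 : 0 <= sin (y / 2).
  apply: sin_ge0_pi; have := @pi_ge3 R; move=> p3; apply/andP; split; lra.
have s2 : sin (y / 2) <= 1 / 2 by apply: (le_trans (@sin_le_id R _ _)); lra.
nra.
Qed.

Lemma cosD2pi_int (R : realType) (x : R) (m : int) : cos (x + pi *+ 2 * m%:~R) = cos x.
Proof.
case: m => n; first by rewrite -pmulrn mulr_natr (periodicn (@cosD2pi R)).
rewrite NegzE mulrNz -pmulrn mulrN mulr_natr.
by rewrite -[LHS](periodicn (@cosD2pi R) n.+1) subrK.
Qed.

(** * Orthogonality of the additive characters modulo q, in real form *)

Definition angle (R : realType) (q n : nat) : R := pi *+ 2 * (n%:R / q%:R).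

Lemma angleD (R : realType) (q m n : nat) : angle R q (m + n) = angle R q m + angle R q n.
Proof. by rewrite /angle natrD; ring. Qed.

Lemma angleM (R : realType) (q n : nat) : (0 < q)%N -> angle R q (q * n) = (pi *+ 2) *+ n.
Proof.
move=> q0; rewrite /angle natrM mulrAC divff ?mul1r ?mulr_natr //.
by rewrite pnatr_eq0 -lt0n.
Qed.

Lemma sum_shift (R : zmodType) (f : nat -> R) (q : nat) :
  (forall a, f (a + q)%N = f a) ->
  forall c, \sum_(0 <= t < q) f (c + t)%N = \sum_(0 <= t < q) f t.
Proof.
move=> fq; elim=> [|c IH]; first by apply: eq_bigr => t _.
rewrite -{}IH; case: q fq => [|q] fq; first by rewrite !big_geq.
rewrite big_nat_recr //= [RHS]big_nat_recl //= addn0 addSn -addnS fq addrC.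
by congr (_ + _); apply: eq_bigr => t _; rewrite addSnnS.
Qed.

Lemma cos_angle_neq1 (R : realType) (q j : nat) : (0 < q)%N -> ~~ (q %| j)%N ->
  cos (angle R q j) != 1.
Proof.
move=> q0 qj; rewrite (divn_eq j q) angleD mulnC angleM // addrC.
rewrite (periodicn (@cosD2pi R)).
have r0 : (0 < j %% q)%N by rewrite lt0n; apply: contra qj; rewrite /dvdn.
have rq : (j %% q < q)%N by rewrite ltn_pmod.
set r := (j %% q)%N in r0 rq *.
rewrite (_ : angle R q r = (pi * (r%:R / q%:R)) *+ 2); last first.
  by rewrite /angle; ring.
rewrite cos_mulr2n cos2sin2.
have p0 := @pi_gt0 R.
have s0 : 0 < sin (pi * (r%:R / q%:R)) :> R.
  apply: sin_gt0_pi; rewrite mulr_gt0 ?divr_gt0 ?ltr0n //=.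
  by rewrite gtr_pMr // ltr_pdivrMr ?ltr0n // mul1r ltr_nat.
apply/eqP; nra.
Qed.

(** Shifting c by one rotates the vector (X, Y) of the two sums by the angle of j, while periodicity
    leaves it fixed; a nontrivial rotation fixes only 0. *)
Lemma sum_cos_sin_angle (R : realType) (q j : nat) : (0 < q)%N -> ~~ (q %| j)%N ->
  \sum_(0 <= c < q) cos (angle R q (j * c)) = 0 /\
  \sum_(0 <= c < q) sin (angle R q (j * c)) = 0.
Proof.
move=> q0 qj; have c1 := cos_angle_neq1 R q0 qj.
have per (f : R -> R) : periodic f (pi *+ 2) ->
    \sum_(0 <= c < q) f (angle R q j + angle R q (j * c)) =
    \sum_(0 <= c < q) f (angle R q (j * c)).
  move=> pf; rewrite -(@sum_shift _ (fun c => f (angle R q (j * c))) q _ 1).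
    by apply: eq_bigr => c _; rewrite mulnDr muln1 angleD.
  by move=> a; rewrite mulnDr angleD (mulnC j q) angleM // periodicn.
move: (per _ (@cosD2pi R)) (per _ (@sinD2pi R)).
under eq_bigr do rewrite cosD.
under [X in _ -> X = _ -> _]eq_bigr do rewrite sinD.
rewrite sumrB big_split /= -!mulr_sumr.
set X := \sum_(0 <= c < q) cos _; set Y := \sum_(0 <= c < q) sin _.
set c := cos (angle R q j) in c1 *; set s := sin _ => h1 h2.
have cs : c ^+ 2 + s ^+ 2 = 1 by exact: cos2Dsin2.
(* This is the determinant of the rotation minus the identity. *)
have c2 : 2 - 2 * c != 0 by apply/eqP => h; move/eqP: c1; apply; lra.
split; apply: (mulfI c2); rewrite mulr0.
  have -> : (2 - 2 * c) * X = (c ^+ 2 + s ^+ 2 + 1 - 2 * c) * X by rewrite cs; ring.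
  have e1 : X - (c * X - s * Y) = 0 by rewrite h1 subrr.
  have e2 : Y - (s * X + c * Y) = 0 by rewrite h2 subrr.
  by rewrite [LHS](_ : _ = (1 - c) * (X - (c * X - s * Y)) - s * (Y - (s * X + c * Y)));
    [rewrite e1 e2; ring|ring].
have -> : (2 - 2 * c) * Y = (c ^+ 2 + s ^+ 2 + 1 - 2 * c) * Y by rewrite cs; ring.
have e1 : X - (c * X - s * Y) = 0 by rewrite h1 subrr.
have e2 : Y - (s * X + c * Y) = 0 by rewrite h2 subrr.
by rewrite [LHS](_ : _ = (1 - c) * (Y - (s * X + c * Y)) + s * (X - (c * X - s * Y)));
  [rewrite e1 e2; ring|ring].
Qed.

(** * Quadratic Gauss sums *)

(** Real part of the quadratic Gauss sum of e(k a^2 / q); [gauss_sin] is its imaginary part. *)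
Definition gauss_cos (R : realType) (q k : nat) : R :=
  \sum_(0 <= a < q) cos (angle R q (k * a ^ 2)).

Definition gauss_sin (R : realType) (q k : nat) : R :=
  \sum_(0 <= a < q) sin (angle R q (k * a ^ 2)).

(** With g = gcd(n, q), q divides n t iff q / g divides t, and g multiples of q / g lie in [0,
    q). *)
Lemma sum_dvd_le_gcd (q n : nat) : (0 < q)%N ->
  (\sum_(0 <= t < q) (q %| n * t) <= gcdn n q)%N.
Proof.
move=> q0; have g0 : (0 < gcdn n q)%N by rewrite gcdn_gt0 q0 orbT.
set g := gcdn n q in g0 *.
have qE : q = (g * (q %/ g))%N by rewrite mulnC divnK // dvdn_gcdr.
have nE : n = (g * (n %/ g))%N by rewrite mulnC divnK // dvdn_gcdl.
set q' := (q %/ g)%N in qE; set n' := (n %/ g)%N in nE.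
have co : coprime q' n'.
  rewrite /coprime -(eqn_pmul2l g0) muln1 muln_gcdr -qE -nE.
  by rewrite gcdnC.
have dvdE t : (q %| n * t)%N = (q' %| t)%N.
  by rewrite {1}qE nE -mulnA dvdn_pmul2l // Gauss_dvdr.
rewrite (eq_bigr (fun t => (q' %| t)%N : nat)); last by move=> t _; rewrite dvdE.
have q'0 : (0 < q')%N by move: q0; rewrite qE muln_gt0 => /andP[].
rewrite big_ltn // dvdn0.
have := divn_count_dvd q' q.-1; rewrite prednK // => <-.
by rewrite add1n ltn_divLR // -qE prednK.
Qed.

(** Weyl differencing: with a = c + t the phase k (a^2 - c^2) becomes k t^2 + 2 k t c, linear in c,
    so the sum over c vanishes unless q divides 2 k t. *)
Lemma gauss_sum_sqr_le (R : realType) (q k : nat) : (0 < q)%N ->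
  gauss_cos R q k ^+ 2 + gauss_sin R q k ^+ 2 <= (q * gcdn (2 * k) q)%:R.
Proof.
move=> q0; set x := fun a : nat => angle R q (k * a ^ 2).
have xper (f : R -> R) : periodic f (pi *+ 2) -> forall a y,
    f (x (a + q)%N - y) = f (x a - y).
  move=> pf a y; rewrite /x.
  rewrite (_ : k * (a + q) ^ 2 = k * a ^ 2 + q * (k * (2 * a + q)))%N; last by ring.
  by rewrite angleD addrAC angleM // periodicn.
have -> : gauss_cos R q k ^+ 2 + gauss_sin R q k ^+ 2 =
    \sum_(0 <= c < q) \sum_(0 <= a < q) cos (x a - x c).
  rewrite !expr2 /gauss_cos /gauss_sin !big_distrr /= -big_split /=.
  apply: eq_bigr => c _; rewrite !big_distrl /= -big_split /=.
  by apply: eq_bigr => a _; rewrite cosB.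
have -> : \sum_(0 <= c < q) \sum_(0 <= a < q) cos (x a - x c) =
    \sum_(0 <= t < q) \sum_(0 <= c < q)
      cos (angle R q (k * t ^ 2) + angle R q (2 * k * t * c)).
  rewrite [RHS]exchange_big_nat /=; apply: eq_bigr => c _.
  rewrite -(sum_shift (fun a => xper _ (@cosD2pi R) a (x c)) c).
  apply: eq_bigr => t _; congr cos; apply/eqP; rewrite subr_eq -!angleD; apply/eqP.
  by rewrite /x; congr angle; ring.
rewrite natrM.
have h t : \sum_(0 <= c < q) cos (angle R q (k * t ^ 2) + angle R q (2 * k * t * c))
    <= q%:R * (q %| 2 * k * t)%:R.
  have [/dvdnP[u ->]|qt] := boolP (q %| 2 * k * t)%N.
    rewrite mulr1 [leRHS](_ : _ = \sum_(0 <= c < q) 1);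
      last by rewrite sumr_const_nat subn0.
    by apply: ler_sum => c _; exact: cos_le1.
  under eq_bigr do rewrite cosD.
  rewrite sumrB -!mulr_sumr.
  by have [-> ->] := sum_cos_sin_angle R q0 qt; rewrite !mulr0 subr0.
apply: (le_trans (ler_sum _ (fun t _ => h t))).
rewrite -mulr_sumr -natr_sum.
by rewrite ler_wpM2l // ler_nat; exact: sum_dvd_le_gcd.
Qed.

(** Cauchy-Schwarz by Lagrange's identity: the double sum of (F i G j - F j G i)^2 is twice the
    difference of the two sides. *)
Lemma sqr_sum_mul_le (R : realDomainType) (I : Type) (r : seq I) (F G : I -> R) :
  (\sum_(i <- r) F i * G i) ^+ 2 <= (\sum_(i <- r) F i ^+ 2) * (\sum_(i <- r) G i ^+ 2).
Proof.
have : 0 <= \sum_(i <- r) \sum_(j <- r) (F i * G j - F j * G i) ^+ 2.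
  by apply: sumr_ge0 => i _; apply: sumr_ge0 => j _; exact: sqr_ge0.
rewrite [X in 0 <= X](_ : _ = 2 * ((\sum_(i <- r) F i ^+ 2) * (\sum_(i <- r) G i ^+ 2) -
   (\sum_(i <- r) F i * G i) ^+ 2)) ?pmulr_rge0 ?subr_ge0 //.
set A := \sum_(i <- r) F i ^+ 2; set B := \sum_(i <- r) G i ^+ 2.
set C := \sum_(i <- r) F i * G i.
rewrite (eq_bigr (fun i => F i ^+ 2 * B + A * G i ^+ 2 - 2 * (F i * G i) * C)); last first.
  move=> i _; rewrite mulr_sumr (mulr_suml _ _ _ (G i ^+ 2)) (mulr_sumr _ _ _ (2 * _)).
  by rewrite -sumrN -!big_split; apply: eq_bigr => j _ /=; ring.
rewrite sumrB big_split /= -!mulr_suml -!mulr_sumr -/A -/B -/C; ring.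
Qed.

(** Bound the gcd by the sum of all d | q that divide 2 k and exchange the sums: at most 2 J / d
    multiples of d lie up to 2 J, so each d contributes at most 2 J. *)
Lemma sum_gcd_le (q J : nat) : (0 < q)%N ->
  (\sum_(1 <= k < J) gcdn (2 * k) q <= 2 * J * size (divisors q))%N.
Proof.
move=> q0.
have h k : (0 < k)%N ->
    (gcdn (2 * k) q <= \sum_(d <- divisors q) d * (d %| 2 * k))%N.
  move=> k0; rewrite (big_rem (gcdn (2 * k) q)) /=; last first.
    by rewrite -dvdn_divisors // dvdn_gcdr.
  by rewrite dvdn_gcdl muln1 leq_addr.
apply: (@leq_trans (\sum_(1 <= k < J) \sum_(d <- divisors q) d * (d %| 2 * k))%N).
  rewrite big_nat_cond [leqRHS]big_nat_cond; apply: leq_sum => k /andP[/andP[k0 _] _].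
  exact: h.
rewrite exchange_big /=.
apply: (@leq_trans (\sum_(d <- divisors q) 2 * J)%N); last first.
  by rewrite big_const_seq count_predT iter_addn_0.
rewrite big_seq_cond [leqRHS]big_seq_cond; apply: leq_sum => d;
  rewrite andbT -dvdn_divisors // => dq.
have d0 : (0 < d)%N by exact: dvdn_gt0 dq.
have h2 : (\sum_(1 <= k < J) (d %| 2 * k) <= \sum_(1 <= i < (2 * J).+1) (d %| i))%N.
  have aux n : (\sum_(1 <= k < n.+1) (d %| 2 * k) <= \sum_(1 <= i < (2 * n).+1) (d %| i))%N.
    elim: n => [|n IH]; first by rewrite big_geq.
    rewrite big_nat_recr //= mulnS !add2n (@big_nat_recr _ _ _ (2 * n).+2) //=
      (@big_nat_recr _ _ _ (2 * n).+1) //=.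
    by rewrite -addnA leq_add // leq_addl.
  case: J => [|J]; first by rewrite big_geq.
  apply: (leq_trans (aux J)).
  rewrite mulnS !add2n (@big_nat_recr _ _ _ (2 * J).+2) //= (@big_nat_recr _ _ _ (2
    * J).+1) //=.
  by rewrite -addnA leq_addr.
rewrite -big_distrr /= mulnC -leq_divRL //; apply: (leq_trans h2).
by rewrite -divn_count_dvd.
Qed.

(** * Squares close to multiples of the modulus *)

(** The condition ||x|| <= b as a boolean, so that it can be summed and can filter big operators;
    [dist_int_le_near] links it to [dist_int]. *)
Definition near_int (R : realType) (b x : R) : bool :=
  `[< exists m : int, `|x - m%:~R| <= b >].

Definition sqr_count (R : realType) (b : R) (q : nat) : nat :=
  \sum_(0 <= a < q) near_int b ((a ^ 2)%:R / q%:R).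

(** With truncated subtraction the argument of h is |j - l|. For fixed j it is 0 once and takes each
    value 0 < k < J at most twice. *)
Lemma sum_dist_le (R : realDomainType) (h : nat -> R) (J : nat) :
  (forall k, 0 <= h k) ->
  \sum_(0 <= j < J) \sum_(0 <= l < J) h ((j - l) + (l - j))%N <=
  J%:R * (h 0%N + 2 * \sum_(1 <= k < J) h k).
Proof.
move=> h0; rewrite -[X in X%:R](subn0 J) mulr_natl -sumr_const_nat.
rewrite big_nat_cond [leRHS]big_nat_cond; apply: ler_sum => j /andP[/andP[_ jJ] _].
rewrite (@big_cat_nat _ _ _ j) //=; last exact: ltnW.
rewrite [X in _ + X]big_ltn // !subnn addrCA lerD2l mulr_natl mulr2n lerD //.
  rewrite big_nat_rev /= add0n (eq_big_nat _ _ (F2 := fun i => h i.+1)); last first.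
    move=> i /andP[_ ij]; congr h; lia.
  rewrite (_ : \sum_(0 <= i < j) h i.+1 = \sum_(1 <= k < j.+1) h k);
    last by rewrite big_add1.
  rewrite [leRHS](@big_cat_nat _ _ _ j.+1 1 J) //=.
  by rewrite lerDl; apply: sumr_ge0.
rewrite -{1}[j.+1]addn1 -[in leLHS](subnK (ltnW jJ)) addnC big_addn addnK.
rewrite (eq_big_nat _ _ (F2 := h)); last first.
  move=> i /andP[i1 ij]; congr h; lia.
rewrite (@big_cat_nat _ _ _ (J - j) 1 J) //=; last 2 first.
- by rewrite subn_gt0.
- by rewrite leq_subr.
by rewrite lerDl; apply: sumr_ge0.
Qed.

Lemma gauss_cos0 (R : realType) (q : nat) : gauss_cos R q 0 = q%:R.
Proof.
rewrite /gauss_cos (eq_bigr (fun=> 1)) ?sumr_const_nat ?subn0 // => a _.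
by rewrite mul0n /angle mul0r mulr0 cos0.
Qed.

(** Cauchy-Schwarz against the constant 1, then the Gauss sum bound and the average of the gcd. *)
Lemma sum_norm_gauss_cos_le (R : realType) (q J : nat) : (0 < q)%N ->
  \sum_(1 <= k < J) `|gauss_cos R q k| <=
  J%:R * Num.sqrt (2 * (q * size (divisors q))%:R).
Proof.
move=> q0; set T := \sum_(1 <= k < J) _.
have T0 : 0 <= T by apply: sumr_ge0.
rewrite -(@ler_pXn2r _ 2) ?nnegrE ?mulr_ge0 ?sqrtr_ge0 // exprMn sqr_sqrtr ?mulr_ge0 //.
have := sqr_sum_mul_le (index_iota 1 J) (fun=> 1) (fun k => `|gauss_cos R q k|).
under eq_bigr do rewrite mul1r.
move=> /le_trans; apply;
  rewrite expr1n sumr_const_nat expr2 -mulrA ler_pM ?ler_nat ?leq_subr //.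
  by apply: sumr_ge0 => k _; exact: sqr_ge0.
apply: (@le_trans _ _ (\sum_(1 <= k < J) (q * gcdn (2 * k) q)%:R)).
  apply: ler_sum => k _; rewrite -normrX ger0_norm ?sqr_ge0 //.
  by apply: le_trans (gauss_sum_sqr_le R k q0); rewrite lerDl sqr_ge0.
rewrite -natr_sum -big_distrr -!natrM ler_nat /=.
by rewrite (leq_trans (leq_mul (leqnn q) (sum_gcd_le J q0))) // leq_eqVlt; apply/orP; left;
  apply/eqP; ring.
Qed.

(** Up to a multiple of 2 pi the phase difference is 2 pi (j - l) (a^2 / q - m), at most 2 pi b J <=
    1 in absolute value, so each of the (J + 1)^2 cosines is at least 1/2. *)
Lemma fejer_near_int_ge (R : realType) (b : R) (q J a : nat) :
  near_int b ((a ^ 2)%:R / q%:R) -> 2 * pi * b * J%:R <= 1 ->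
  J.+1%:R ^+ 2 / 2 <= \sum_(0 <= j < J.+1) \sum_(0 <= l < J.+1)
     cos (angle R q (j * a ^ 2) - angle R q (l * a ^ 2)).
Proof.
move=> /asboolP[m hm] bJ.
have c j l : (j <= J)%N -> (l <= J)%N ->
    1 / 2 <= cos (angle R q (j * a ^ 2) - angle R q (l * a ^ 2)).
  move=> jJ lJ; set x : R := (a ^ 2)%:R / q%:R in hm.
  have angE i : angle R q (i * a ^ 2) = 2 * pi * (i%:R * x).
    by rewrite /angle natrM /x; ring.
  have -> : angle R q (j * a ^ 2) - angle R q (l * a ^ 2) =
      2 * pi * ((j%:R - l%:R) * (x - m%:~R)) + pi *+ 2 * ((Posz j - Posz l) * m)%:~R.
    by rewrite !angE intrM rmorphB /= -!pmulrn; ring.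
  rewrite cosD2pi_int; apply: cos_ge_half; apply: le_trans bJ.
  rewrite !normrM (ger0_norm (@pi_ge0 R)) (ger0_norm (ler0n _ 2)) -[leRHS]mulrA.
  rewrite ler_wpM2l ?mulr_ge0 ?pi_ge0 // [leRHS]mulrC ler_pM //.
  have : (j%:R <= J%:R :> R) by rewrite ler_nat.
  have : (l%:R <= J%:R :> R) by rewrite ler_nat.
  have := ler0n R j; have := ler0n R l; rewrite ler_norml => ? ? ? ?.
  by apply/andP; split; lra.
rewrite (_ : _ / 2 = \sum_(0 <= j < J.+1) \sum_(0 <= l < J.+1) (1 / 2)); last first.
  by rewrite !sumr_const_nat !subn0; ring.
rewrite big_nat_cond [leRHS]big_nat_cond; apply: ler_sum => j /andP[/andP[_ jJ] _].
rewrite big_nat_cond [leRHS]big_nat_cond; apply: ler_sum => l /andP[/andP[_ lJ] _].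
exact: c.
Qed.

(** The Fejer kernel K a = |sum over j <= m of e(j a^2 / q)|^2 is never negative and is at least J^2
    / 2 at the counted a. Summed over all a it yields Gauss sums of frequency |j - l|. *)
Lemma sqr_count_le (R : realType) (b : R) (q : nat) : 0 < b -> (0 < q)%N ->
  (sqr_count b q)%:R <=
  4 * pi * b * q%:R + 4 * Num.sqrt (2 * (q * size (divisors q))%:R).
Proof.
move=> b0 q0; have p3 := @pi_ge3 R.
have pb0 : 0 < 2 * pi * b by rewrite mulr_gt0 //; lra.
(* The largest m with 2 pi b m <= 1, so that 1 / J < 2 pi b for J = m + 1. *)
set m := Num.truncn (2 * pi * b)^-1; set N : R := (sqr_count b q)%:R.
have /andP[mle mlt] : m%:R <= (2 * pi * b)^-1 < m.+1%:R by apply: truncn_itv;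
  rewrite invr_ge0 ltW.
set J : R := m.+1%:R in mlt.
set K := fun a => \sum_(0 <= j < m.+1) \sum_(0 <= l < m.+1)
     cos (angle R q (j * a ^ 2) - angle R q (l * a ^ 2)).
have K0 a : 0 <= K a.
  rewrite (_ : K a = (\sum_(0 <= j < m.+1) cos (angle R q (j * a ^ 2))) ^+ 2 +
     (\sum_(0 <= j < m.+1) sin (angle R q (j * a ^ 2))) ^+ 2) ?addr_ge0 ?sqr_ge0 //.
  rewrite !expr2 !big_distrl /= -big_split /=.
  apply: eq_bigr => c _; rewrite !big_distrr /= -big_split /=.
  by apply: eq_bigr => d _; rewrite cosB.
have low : N * (J ^+ 2 / 2) <= \sum_(0 <= a < q) K a.
  rewrite /N /sqr_count natr_sum mulr_suml; apply: ler_sum => a _.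
  case na: (near_int b _); rewrite ?mul0r // mul1r; apply: fejer_near_int_ge na _.
  by rewrite -ler_pdivlMl // mulr1.
have up : \sum_(0 <= a < q) K a <= J * (q%:R + 2 * (J * Num.sqrt (2 * (q * size
  (divisors q))%:R))).
  rewrite exchange_big_nat /=.
  under eq_bigr do rewrite exchange_big_nat /=.
  set h := fun k => `|gauss_cos R q k|.
  apply: (@le_trans _ _ (\sum_(0 <= j < m.+1) \sum_(0 <= l < m.+1) h ((j - l) + (l
    - j))%N)).
    apply: ler_sum => j _; apply: ler_sum => l _.
    apply: (le_trans (ler_norm _)); rewrite /h /gauss_cos le_eqVlt; apply/orP; left;
      apply/eqP.
    congr (`|_|); apply: eq_bigr => a _.
    have [lj|/ltnW jl] := leqP l j.
      rewrite (_ : l - j = 0)%N ?addn0; last by apply/eqP; rewrite subn_eq0.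
      by rewrite -{1}(subnK lj) mulnDl angleD addrK.
    rewrite -cosN opprB (_ : j - l = 0)%N ?add0n; last by apply/eqP; rewrite subn_eq0.
    by rewrite -{1}(subnK jl) mulnDl angleD addrK.
  apply: (le_trans (sum_dist_le _ _)) => [k|]; first exact: normr_ge0.
  rewrite ler_wpM2l // /h gauss_cos0 ger0_norm // lerD2l ler_wpM2l //.
  exact: sum_norm_gauss_cos_le.
have J0 : 0 < J by [].
have := le_trans low up; set T := Num.sqrt _ => H.
have H2 : N <= 2 * q%:R / J + 4 * T.
  rewrite -(@ler_pM2r _ (J ^+ 2 / 2)) ?divr_gt0 ?exprn_gt0 //; apply: (le_trans H).
  by rewrite le_eqVlt; apply/orP; left; apply/eqP; field; rewrite gt_eqF.
apply: (le_trans H2); rewrite lerD2r.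
have : J^-1 <= 2 * pi * b by rewrite -[leRHS]invrK lef_pV2 ?posrE ?invr_gt0 // ltW.
rewrite (_ : 4 * pi * b * q%:R = 2 * q%:R * (2 * pi * b)); last by ring.
by apply: ler_wpM2l; rewrite mulr_ge0.
Qed.

(** * Removing a prime from the modulus *)

Lemma sqr_count_card (R : realType) (b : R) (q : nat) :
  sqr_count b q = #|[set a : 'I_q | near_int b ((a ^ 2)%:R / q%:R)]%SET|.
Proof.
rewrite /sqr_count big_mkord -sum1_card [RHS]big_mkcond /=.
by apply: eq_bigr => a _; rewrite inE; case: near_int.
Qed.

Lemma card_le_fibers (T U : finType) (f : T -> U) (A : {set T}) (n : nat) :
  (forall y, #|[set x in A | f x == y]%SET| <= n)%N -> (#|A| <= n * #|f @: A|)%N.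
Proof.
move=> fn; rewrite -sum1_card (partition_big_imset f) /= mulnC -sum_nat_const.
apply: leq_sum => y _; apply: leq_trans (fn y); rewrite -[leqRHS]sum1_card.
by apply: eq_leq; apply: eq_bigl => x; rewrite !inE.
Qed.

(** If some integer is within b of x, then so is the floor of x + b; this canonical witness is what
    locates the representative of a^2 below. *)
Lemma near_intP (R : realType) (b x : R) :
  reflect (x + b - (Num.floor (x + b))%:~R <= 2 * b) (near_int b x).
Proof.
apply: (iffP idP).
  move=> /asboolP[m]; rewrite ler_norml => /andP[h1 h2].
  have : m%:~R <= (Num.floor (x + b))%:~R :> R.
    by rewrite ler_int floor_ge_int; lra.
  lra.
move=> h; apply/asboolP; exists (Num.floor (x + b)).
by have := floor_le (x + b); rewrite ler_norml => ?; apply/andP; split; lra.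
Qed.

(* The pairs counted on the right are (a %% q, i), where i locates the representative
   c of a^2 modulo p * q with |c| <= b p q up to an error less than q. As c is known
   modulo q, the pair determines c, hence a up to two choices modulo p. *)
Lemma sqr_count_mul_prime_le (R : realType) (b : R) (p q : nat) :
  0 < b -> prime p -> coprime p q -> (0 < q)%N ->
  (sqr_count b (p * q) <=
   2 * (sqr_count (b * p%:R) q * (Num.truncn (2 * b * p%:R)).+1))%N.
Proof.
move=> b0 pp cpq q0; have p0 := prime_gt0 pp.
rewrite !sqr_count_card; set n := Num.truncn _.
set x := fun a : nat => (a ^ 2)%:R / (p * q)%:R : R.
set fr := fun a => x a + b - (Num.floor (x a + b))%:~R.
set A := [set a : 'I_(p * q) | _]%SET; set B := [set a : 'I_q | _]%SET.
pose f (a : 'I_(p * q)) : 'I_q * 'I_n.+1 :=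
  (Ordinal (ltn_pmod a q0), inord (Num.truncn (p%:R * fr a))).
have pR : 0 < p%:R :> R by rewrite ltr0n.
have qR : 0 < q%:R :> R by rewrite ltr0n.
have fr0 a : 0 <= fr a by rewrite subr_ge0 floor_le.
have frA (a : 'I__) : a \in A -> fr a <= 2 * b by rewrite inE => /near_intP.
have trA (a : 'I__) : a \in A -> (Num.truncn (p%:R * fr a) < n.+1)%N.
  move=> aA; rewrite ltnS; apply: le_truncn; rewrite mulrC ler_wpM2r //; exact: frA.
have fA : f @: A \subset finset.setX B [set: 'I_n.+1]%SET.
  apply/fintype.subsetP => _ /imsetP[a aA ->]; rewrite !inE /= andbT.
  move: aA; rewrite inE => /asboolP[m hm]; apply/asboolP.
  (* Up to an integer, r^2 / q equals a^2 / q = p (a^2 / (p q)), so the tolerance b becomes b p. *)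
  exists (Posz p * m - Posz (a %/ q * (a %/ q * q + 2 * (a %% q)))).
  set t := (a %/ q)%N; set r := (a %% q)%N.
  have aE : a = (t * q + r)%N :> nat by exact: divn_eq.
  have -> : (r ^ 2)%:R / q%:R - (Posz p * m - Posz (t * (t * q + 2 * r)))%:~R =
     p%:R * ((a ^ 2)%:R / (p * q)%:R - m%:~R) :> R.
    rewrite aE rmorphB rmorphM /= -!pmulrn !(natrM, natrX, natrD); field.
    by rewrite !gt_eqF.
  by rewrite normrM ger0_norm // mulrC ler_wpM2r.
apply: (@leq_trans (2 * #|f @: A|)); last first.
  by rewrite leq_mul2l /=; apply: leq_trans (subset_leq_card fA) _;
    rewrite cardsX cardsT card_ord.
apply: card_le_fibers => -[y i]; set F := [set a in A | _]%SET.
(* In a fibre, a^2 - c^2 = q u, and the integer u - p (ma - mc) = p fr a - p fr c is 0, both terms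
   having the same integer part. So p divides u; the quotients of a and c by q differ by less than
   p, and if they agree then a = c. Hence p divides a + c. *)
have key (a c : 'I__) : a \in F -> c \in F -> a != c -> (p %| a + c)%N.
  rewrite !inE => /andP[aA /eqP fa] /andP[cA /eqP fc] ac.
  have [fac1 fac2] : (a %% q = c %% q)%N /\
      Num.truncn (p%:R * fr a) = Num.truncn (p%:R * fr c).
    have := etrans fa (esym fc); case=> h1 h2; split=> //.
    by move/(congr1 val): h2; rewrite /= !inordK // trA // inE.
  set u := ((Posz (a %/ q) - Posz (c %/ q)) * Posz (a + c))%R.
  set ma := Num.floor (x a + b); set mc := Num.floor (x c + b).
  have uE : u = (Posz p * (ma - mc))%R.
    have zE : (u - Posz p * (ma - mc))%:~R = p%:R * fr a - p%:R * fr c :> R.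
      rewrite /fr -/ma -/mc /x /u rmorphB !rmorphM /= !rmorphB /= -!pmulrn.
      rewrite (divn_eq a q) (divn_eq c q) fac1; set ta := (a %/ q)%N; set tc := (c %/ q)%N.
      set r := (c %% q)%N.
      rewrite !divnMDl // !(natrM, natrX, natrD).
      have -> : (r %/ q = 0)%N by rewrite divn_small // ltn_pmod.
      by field; rewrite !gt_eqF.
    apply/eqP; rewrite -subr_eq0 -absz_eq0; apply/eqP.
    have : `|(u - Posz p * (ma - mc))%:~R| < 1 :> R.
      have := @truncn_itv R (p%:R * fr a) (mulr_ge0 (ltW pR) (fr0 a)).
      have := @truncn_itv R (p%:R * fr c) (mulr_ge0 (ltW pR) (fr0 c)).
      rewrite zE fac2 -!natr1 => /andP[? ?] /andP[? ?].
      by rewrite ltr_norml; apply/andP; split; lra.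
    by rewrite -intr_norm ltrz1 -abszE; lia.
  have : (p %| `|(Posz (a %/ q) - Posz (c %/ q))%R| * (a + c))%N.
    by rewrite -[(a + c)%N]absz_nat -abszM -/u uE abszM dvdn_mulr.
  rewrite Euclid_dvdM // => /orP[|//] h.
  have lt e : (e < p * q)%N -> (e %/ q < p)%N by rewrite ltn_divLR.
  have := lt _ (ltn_ord a); have := lt _ (ltn_ord c) => hc ha.
  have /eqP : `|(Posz (a %/ q) - Posz (c %/ q))%R|%N = 0%N.
    move: h ha hc; move: (a %/ q)%N (c %/ q)%N => ta tc h ha hc.
    apply/eqP; rewrite -leqn0 leqNgt; apply/negP => /dvdn_leq /(_ h) h'.
    by move: h' ha hc; clear; lia.
  rewrite absz_eq0 subr_eq0 => /eqP[e].
  by move/eqP: ac; case; apply: val_inj; rewrite /= (divn_eq a q) e fac1 -divn_eq.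
have [->|/set0Pn[a aF]] := eqVneq F finset.set0; first by rewrite cards0.
(* All members other than a are congruent to -a modulo p and share their residue modulo q, so the
   Chinese remainder theorem leaves at most one. *)
rewrite (cardsD1 a) aF add1n ltnS; apply/card_le1_eqP => c d.
rewrite [_ \in finset.setD _ _]finset.in_setD1 => /andP[ca cF].
rewrite [_ \in finset.setD _ _]finset.in_setD1 => /andP[da dF].
have hc := key _ _ aF cF; have hd := key _ _ aF dF.
rewrite eq_sym in ca; rewrite eq_sym in da; move: hc hd => /(_ ca) hc /(_ da) hd.
have cdp : c = d %[mod p].
  apply/eqP; rewrite -(eqn_modDl a); apply/eqP.
  by rewrite (eqP hc) (eqP hd).
have cdq : c = d %[mod q].
  move: cF dF; rewrite !inE => /andP[_ /eqP fc] /andP[_ /eqP fd].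
  by have := etrans fc (esym fd); case.
apply: val_inj => /=; rewrite -(modn_small (ltn_ord c)) -(modn_small (ltn_ord d)).
by apply/eqP; rewrite chinese_remainder // cdp cdq !eqxx.
Qed.

Lemma sqr_count_le_modulus (R : realType) (b : R) (q : nat) : (sqr_count b q <= q)%N.
Proof.
rewrite /sqr_count -[leqRHS]subn0 -[leqRHS]muln1 -sum_nat_const_nat.
by apply: leq_sum => a _; case: near_int.
Qed.

(** If 2 b p < 1, the index i takes one value and [sqr_count_le] applies modulo q with tolerance b
    p. Otherwise the trivial count q and at most 4 b p indices give 8 b p q, below the main term. *)
Lemma sqr_count_mul_prime_le_sqrt (R : realType) (b : R) (p q : nat) :
  0 < b -> prime p -> coprime p q -> (0 < q)%N ->
  (sqr_count b (p * q))%:R <= 8 * pi * b * (p * q)%:R +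
    8 * Num.sqrt (2 * (q * size (divisors q))%:R).
Proof.
move=> b0 pp cpq q0; have p0 : 0 < p%:R :> R by rewrite ltr0n prime_gt0.
have qR : 0 < q%:R :> R by rewrite ltr0n.
have p3 := @pi_ge3 R.
set s := Num.sqrt _; have s0 : 0 <= s by exact: sqrtr_ge0.
have bp0 : 0 < b * p%:R by exact: mulr_gt0.
have := sqr_count_mul_prime_le b0 pp cpq q0.
rewrite -(ler_nat R) => /le_trans; apply; rewrite !natrM.
have [bp1|bp1] := ltP (2 * b * p%:R) 1.
  have -> : Num.truncn (2 * b * p%:R) = 0%N.
    by apply: truncn_def; rewrite bp1 andbT; nra.
  rewrite mulr1; have := sqr_count_le bp0 q0; rewrite -/s => h.
  by move: h; set X := sqr_count _ _; nra.
have h1 : (sqr_count (b * p%:R) q)%:R <= q%:R :> R by rewrite ler_nat sqr_count_le_modulus.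
have h2 : (Num.truncn (2 * b * p%:R)).+1%:R <= 4 * (b * p%:R).
  by rewrite -natr1;
    have /andP[] := @truncn_itv R (2 * b * p%:R) (ltW (lt_le_trans ltr01 bp1)); lra.
have h3 : (sqr_count (b * p%:R) q)%:R * (Num.truncn (2 * b * p%:R)).+1%:R <= q%:R * (4 * (b
  * p%:R)) :> R.
  by apply: ler_pM.
have h4 : 0 <= (pi - 1) * (b * (p%:R * q%:R)).
  by rewrite !mulr_ge0 //; lra.
lra.
Qed.

(** * Sums over smooth numbers *)

(** Substitute m = d k. The right side also contains terms with d k >= N, whence the inequality. *)
Lemma sum_multiples_le (R : numDomainType) (d N : nat) (Q : pred nat) (G : nat -> R) :
  (0 < d)%N -> (forall m, 0 <= G m) ->
  \sum_(1 <= m < N | (d %| m)%N && Q m) G (m %/ d)%N <=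
  \sum_(1 <= m < N | Q (d * m)%N) G m.
Proof.
move=> d0 G0.
apply: (@le_trans _ _ (\sum_(1 <= m < N) \sum_(1 <= k < N | (d * k == m)%N && Q (d
  * k)%N) G k)).
  rewrite big_mkcond /= big_nat_cond [leRHS]big_nat_cond.
  apply: ler_sum => m /andP[/andP[m0 mN] _].
  case: ifP => [/andP[/dvdnP[k mE] Qm]|_]; last by apply: sumr_ge0.
  rewrite mE mulnK // (big_rem k) /=; last first.
    rewrite mem_index_iota; apply/andP; split; first by case: k mE m0 => // ->.
    by apply: leq_ltn_trans mN; rewrite mE leq_pmulr.
  by rewrite mulnC eqxx -mE Qm lerDl sumr_ge0.
rewrite (exchange_big_dep xpredT) //= [leRHS]big_mkcond /=; apply: ler_sum => k _.
case: ifP => Qk; last by rewrite big1 // => m /andP[].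
rewrite (eq_bigl (fun m => m == (d * k)%N)); last by move=> m; rewrite ?Qk ?andbT eq_sym.
rewrite -big_filter; set s := seq.filter _ _.
have : (size s <= 1)%N.
  by rewrite size_filter (eq_count (a2 :=
    pred1 (d * k)%N)) // count_uniq_mem ?iota_uniq // leq_b1.
by case: s => [|x [|]] // _; rewrite ?big_nil ?big_seq1.
Qed.

(** The form in which n-smoothness is used; since [max_pdiv 1] is 1, the number 1 is n-smooth for
    every n > 0. *)
Lemma max_pdiv_leqP (n m : nat) : (0 < n)%N -> (0 < m)%N ->
  reflect (forall p, prime p -> (p %| m)%N -> (p <= n)%N) (max_pdiv m <= n)%N.
Proof.
move=> n0 m0; apply: (iffP idP) => [mn p pp pm|h].
  by apply: leq_trans mn; apply: max_pdiv_max; rewrite mem_primes pp m0.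
have [->|m1] := eqVneq m 1%N; first by [].
have m2 : (1 < m)%N by rewrite ltn_neqAle eq_sym m1.
by apply: h; rewrite ?max_pdiv_prime ?max_pdiv_dvd.
Qed.

Lemma max_pdiv_leq_dvd (n d m : nat) : (0 < n)%N -> (0 < m)%N -> (d %| m)%N ->
  (max_pdiv m <= n)%N -> (max_pdiv d <= n)%N.
Proof.
move=> n0 m0 dm /(max_pdiv_leqP n0 m0) h.
apply/max_pdiv_leqP => // [|p pp pd]; first exact: dvdn_gt0 dm.
by apply: h => //; exact: dvdn_trans dm.
Qed.

(** Upper half of the Euler product of a completely multiplicative g, kept finite by the cutoff N;
    induction on n. *)
Lemma sum_smooth_le (R : realFieldType) (g : nat -> R)
  (g0 : forall n, 0 <= g n) (g1 : g 1%N = 1)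
  (gM : forall m n, g (m * n)%N = g m * g n) (gp : forall p, prime p -> g p < 1)
  (n N : nat) : (0 < n)%N ->
  \sum_(1 <= m < N | (max_pdiv m <= n)%N) g m <=
  \prod_(1 <= p < n.+1 | prime p) (1 - g p)^-1.
Proof.
elim: n => // -[|n] IH _.
  rewrite [leRHS]big_nat_cond [leRHS]big1; last by move=> [|[|]] //= i /andP[].
  have [N1|N1] := leqP N 1; first by rewrite big_geq.
  rewrite big_ltn_cond //= g1 big_nat_cond big1 ?addr0 // => m /andP[/andP[m2 _]].
  by move=> /(max_pdiv_leqP (ltnSn 0) (ltnW m2))/(_ _ (pdiv_prime m2) (pdiv_dvd m));
    rewrite leqNgt prime_gt1 ?pdiv_prime.
have {}IH := IH isT; set p := n.+2.
set S := \sum_(1 <= m < N | (max_pdiv m <= p)%N) g m.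
(* If p is prime, writing p * m for the numbers divisible by p turns this into
   S <= (sum for n.+1) + g p * S. *)
have split_le : S <= \sum_(1 <= m < N | (max_pdiv m <= n.+1)%N) g m +
    \sum_(1 <= m < N | (max_pdiv m == p)%N) g m.
  rewrite /S big_mkcond [X in _ <= X + _]big_mkcond [X in _ <= _ + X]big_mkcond
    -big_split /=.
  apply: ler_sum => m _; rewrite leq_eqVlt ltnS.
  by case: eqP => _ /=; case: leqP => _ /=; rewrite ?addr0 ?add0r // lerDl.
rewrite big_mkcond big_nat_recr //= -big_mkcond /= -/p.
have [pp|np] := boolP (prime p).
  have gp1 := gp _ pp; rewrite mulrC ler_pdivlMl ?subr_gt0 //.
  apply: le_trans IH; rewrite mulrBl mul1r lerBlDr; apply: (le_trans split_le).
  rewrite lerD2l.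
  apply: (@le_trans _ _ (\sum_(1 <= m < N | (p %| m)%N && (max_pdiv m <= p)%N) (g p * g
    (m %/ p)%N))).
    rewrite big_mkcond [leRHS]big_mkcond /= big_nat_cond [leRHS]big_nat_cond.
    apply: ler_sum => m /andP[/andP[m1 _] _]; case: eqP => [mp|_]; last first.
      by case: ifP => _ //; rewrite mulr_ge0.
    by rewrite mp leqnn -mp max_pdiv_dvd /= -gM mulnC divnK // max_pdiv_dvd.
  have := @sum_multiples_le _ p N (fun m => (max_pdiv m <= p)%N) (fun m => g p * g m) isT.
  move=> /(_ (fun m => mulr_ge0 (g0 p) (g0 m))) /le_trans; apply.
  rewrite /S mulr_sumr big_mkcond [leRHS]big_mkcond /= big_nat_cond [leRHS]big_nat_cond.
  apply: ler_sum => m /andP[/andP[m1 _] _]; case: ifP => h; last first.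
    by case: ifP => _ //; rewrite mulr_ge0.
  by rewrite (@max_pdiv_leq_dvd p m (p * m)) ?muln_gt0 ?dvdn_mull.
rewrite mulr1; apply: le_trans IH; apply: (le_trans split_le).
rewrite gerDl big_nat_cond big1 // => m /andP[/andP[m1 _] /eqP mp].
have [m1'|m1'] := eqVneq m 1%N; first by rewrite m1' in mp.
by move: np; rewrite -mp max_pdiv_prime // ltn_neqAle eq_sym m1'.
Qed.

Lemma size_divisors_sum (m N : nat) : (0 < m < N)%N ->
  size (divisors m) = (\sum_(1 <= d < N | d %| m) 1)%N.
Proof.
move=> /andP[m0 mN]; rewrite -sum1_size -[RHS]big_filter; apply: perm_big.
apply: uniq_perm; rewrite ?divisors_uniq ?filter_uniq ?iota_uniq // => d.
rewrite mem_filter mem_index_iota -dvdn_divisors //.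
have [dm|//] := boolP (d %| m)%N.
by rewrite (dvdn_gt0 m0 dm) (leq_ltn_trans (dvdn_leq m0 dm) mN).
Qed.

(** tau g is the Dirichlet convolution of g with itself, because g d * g (m / d) = g m for d | m; so
    the sum is at most the square of the smooth sum of g. *)
Lemma sum_smooth_divisors_le (R : realFieldType) (g : nat -> R)
  (g0 : forall n, 0 <= g n) (g1 : g 1%N = 1)
  (gM : forall m n, g (m * n)%N = g m * g n) (gp : forall p, prime p -> g p < 1)
  (n N : nat) : (0 < n)%N ->
  \sum_(1 <= m < N | (max_pdiv m <= n)%N) (size (divisors m))%:R * g m <=
  (\prod_(1 <= p < n.+1 | prime p) (1 - g p)^-1) ^+ 2.
Proof.
move=> n0; set S := \sum_(1 <= m < N | (max_pdiv m <= n)%N) g m.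
have S0 : 0 <= S by apply: sumr_ge0.
apply: (@le_trans _ _ (S ^+ 2)); last first.
  have h := sum_smooth_le g0 g1 gM gp N n0; rewrite ler_pXn2r // nnegrE; exact: le_trans h.
apply: (@le_trans _ _ (\sum_(1 <= m < N | (max_pdiv m <= n)%N)
    \sum_(1 <= d < N | (d %| m)%N) g d * g (m %/ d)%N)).
  rewrite big_nat_cond [leRHS]big_nat_cond; apply: ler_sum => m /andP[mN _].
  rewrite (size_divisors_sum mN) natr_sum mulr_suml; apply: ler_sum => d dm.
  by rewrite mul1r -gM mulnC divnK.
rewrite (exchange_big_dep_nat xpredT) //= expr2 {1}/S mulr_suml [leRHS]big_mkcond /=.
rewrite big_nat_cond [leRHS]big_nat_cond; apply: ler_sum => d /andP[/andP[d0 dN] _].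
rewrite (eq_bigl (fun m => (d %| m)%N && (max_pdiv m <= n)%N)); last by move=> m;
  rewrite andbC.
have := @sum_multiples_le _ d N (fun m => (max_pdiv m <= n)%N) (fun m => g d * g m) d0.
move=> /(_ (fun m => mulr_ge0 (g0 d) (g0 m))) /le_trans; apply.
case: ifP => hd.
  rewrite /S mulr_sumr big_mkcond [leRHS]big_mkcond /= big_nat_cond [leRHS]big_nat_cond.
  apply: ler_sum => m /andP[/andP[m1 _] _]; case: ifP => h; last first.
    by case: ifP => _ //; rewrite mulr_ge0.
  by rewrite (@max_pdiv_leq_dvd n m (d * m)) ?muln_gt0 ?d0 ?dvdn_mull.
rewrite big_nat_cond big1 // => m /andP[/andP[m1 _] h].
by rewrite (@max_pdiv_leq_dvd n d (d * m)) ?muln_gt0 ?d0 ?dvdn_mulr in hd.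
Qed.

(** A divisor of p m divides m or is p times a divisor of m. *)
Lemma size_divisors_mul_prime (p m : nat) : prime p -> (0 < m)%N ->
  (size (divisors (p * m)) <= 2 * size (divisors m))%N.
Proof.
move=> pp m0; have pm0 : (0 < p * m)%N by rewrite muln_gt0 prime_gt0.
rewrite mul2n -addnn -[X in (_ <= _ + X)%N](size_map (muln p)) -size_cat.
apply: uniq_leq_size; rewrite ?divisors_uniq // => d.
rewrite -dvdn_divisors // mem_cat -dvdn_divisors // => dpm.
have [/dvdnP[k dE]|pd] := boolP (p %| d)%N.
  apply/orP; right; apply/mapP; exists k; rewrite ?dE 1?mulnC // -dvdn_divisors //.
  by rewrite -(@dvdn_pmul2l p) ?prime_gt0 // mulnC -dE.
by rewrite -(Gauss_dvdr _ (n := p)) ?dpm // coprime_sym prime_coprime.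
Qed.

(** * An upper bound for the Mertens product *)

Definition mertens_prod (R : realFieldType) (n : nat) : R :=
  \prod_(1 <= p < n.+1 | prime p) (1 - p%:R^-1)^-1.

Lemma euler_factor_ge1 (R : realFieldType) (n : nat) : (1 < n)%N ->
  1 <= (1 - n%:R^-1)^-1 :> R.
Proof.
move=> n1; have : n%:R^-1 <= 2^-1 :> R.
  by rewrite lef_pV2 ?posrE ?ltr0n ?ler_nat // (ltn_trans _ n1).
have : 0 <= n%:R^-1 :> R by rewrite invr_ge0.
by move=> ? ?; rewrite invf_ge1; lra.
Qed.

Lemma mertens_prod_ge0 (R : realFieldType) (n : nat) : 0 <= mertens_prod R n.
Proof.
by apply: prodr_ge0 => p /prime_gt1/(euler_factor_ge1 R)/(le_trans ler01).
Qed.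

Lemma mertens_prodS (R : realFieldType) (n : nat) : (0 < n)%N ->
  mertens_prod R n.+1 =
  mertens_prod R n * (if prime n.+1 then (1 - n.+1%:R^-1)^-1 else 1).
Proof. by move=> n0; rewrite /mertens_prod big_mkcond big_nat_recr //= -big_mkcond. Qed.

Lemma mertens_prod_homo (R : realFieldType) (m n : nat) : (0 < m <= n)%N ->
  mertens_prod R m <= mertens_prod R n.
Proof.
move=> /andP[m0]; elim: n => [|n IH]; first by case: m m0.
rewrite leq_eqVlt ltnS => /predU1P[->//|mn]; apply: (le_trans (IH mn)).
rewrite mertens_prodS ?(leq_trans m0) // ler_peMr ?mertens_prod_ge0 //.
by case: ifP => // /prime_gt1/(euler_factor_ge1 R).
Qed.

(** A third of the residues modulo 6 are prime to 6, so the product is O(n^(1/3)); hence the cube.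
    The induction needs the cubed factor of one period to be at most (x + 5) / (x - 1). *)
Lemma mertens_prod6_le (R : realFieldType) (k : nat) : (0 < k)%N ->
  mertens_prod R (6 * k) ^+ 3 <= 11 * ((6 * k)%:R - 1).
Proof.
elim: k => // -[|k] IH _.
  have m1 : mertens_prod R 1 = 1 by rewrite /mertens_prod big_mkcond big_nat1.
  (* The primes 2, 3, 5 give 2 * 3/2 * 5/4 = 15/4, whose cube is just below 55 = 11 * 5; this fixes
     the constant 11. *)
  rewrite muln1; do 5 (rewrite mertens_prodS //=); rewrite m1 [X in X ^+ 3](_ : _ = 15 / 4);
    [lra|by field].
have {}IH := IH isT; set n := (6 * k.+1)%N in IH *.
rewrite (_ : 6 * k.+2 = n.+4.+2)%N; last by rewrite /n; lia.
have n6 : (6 <= n)%N by rewrite /n; lia.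
have np d m : (d \in [:: 2; 3])%N -> (d < m)%N -> (d %| m)%N -> prime m = false.
  move=> d23 dm dvm; apply/negP => /primeP[_ /(_ _ dvm)] /orP[|] /eqP e.
    by rewrite e in d23.
  by rewrite e ltnn in dm.
set x : R := n%:R in IH *; have x6 : 6 <= x by rewrite ler_nat.
have H0 := mertens_prod_ge0 R n; set H := mertens_prod R n in IH H0 *.
(* Among n + 1, ..., n + 6 only n + 1 and n + 5 are prime to 6. *)
have fac m : (6 < m)%N -> (if prime m then (1 - m%:R^-1)^-1 else 1) <= m%:R / (m%:R
  - 1) :> R.
  move=> m6; have : 6 < m%:R :> R by rewrite ltr_nat.
  move=> m6'; have e : (1 - m%:R^-1)^-1 = m%:R / (m%:R - 1) :> R by field;
    rewrite !gt_eqF //; lra.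
  rewrite -e; case: ifP => // _; apply: euler_factor_ge1; lia.
have le : mertens_prod R n.+4.+2 <= H * ((x + 1) / x) * ((x + 5) / (x + 4)).
  do 6 (rewrite mertens_prodS; last by lia).
  rewrite (_ : prime n.+2 = false); last by apply: (np 2%N) => //; rewrite /n; lia.
  rewrite (_ : prime n.+3 = false); last by apply: (np 3%N) => //; rewrite /n; lia.
  rewrite (_ : prime n.+4 = false); last by apply: (np 2%N) => //; rewrite /n; lia.
  rewrite (_ : prime n.+4.+2 = false); last by apply: (np 2%N) => //; rewrite /n; lia.
  rewrite !mulr1 -/H.
  have f1 := fac n.+1 (n6 : (6 < n.+1)%N).
  have f5 := fac n.+4.+1 (leq_trans n6 (leq_addl 4 n) : (6 < n.+4.+1)%N).
  have e1 : n.+1%:R = x + 1 by rewrite -natr1.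
  have e5 : n.+4.+1%:R = x + 5 by rewrite (_ : n.+4.+1 = n + 5)%N ?natrD //; lia.
  rewrite e1 addrK in f1; rewrite e5 (_ : x + 5 - 1 = x + 4) in f5; last by lra.
  have ge (m : nat) : 0 <= (if prime m then (1 - m%:R^-1)^-1 else 1) :> R.
    by case: ifP => // /prime_gt1/(euler_factor_ge1 R)/(le_trans ler01).
  rewrite e1 e5 in f1 f5 *; have := ge n.+1; have := ge n.+4.+1; rewrite e1 e5 => g5 g1.
  by apply: ler_pM => //; [apply: mulr_ge0|apply: ler_wpM2l].
have le3 : mertens_prod R n.+4.+2 ^+ 3 <= (H * ((x + 1) / x) * ((x + 5) / (x + 4))) ^+ 3.
  by rewrite ler_pXn2r ?nnegrE ?mertens_prod_ge0 // (le_trans _ le) ?mertens_prod_ge0.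
apply: (le_trans le3).
have -> : n.+4.+2%:R - 1 = x + 5 :> R by rewrite (_ : n.+4.+2 = n + 6)%N ?natrD -/x;
  [lra|lia].
rewrite [leLHS](_ : _ = H ^+ 3 * (((x + 1) * (x + 5)) / (x * (x + 4))) ^+ 3); last first.
  by field; rewrite !gt_eqF //; lra.
set F := _ ^+ 3 in |- *.
apply: (@le_trans _ _ (11 * (x - 1) * (((x + 1) * (x + 5)) / (x * (x + 4))) ^+ 3)).
  rewrite ler_wpM2r // exprn_ge0 // divr_ge0 // mulr_ge0; lra.
rewrite expr_div_n mulrA ler_pdivrMr ?exprn_gt0 ?mulr_gt0 //; try lra.
(* In terms of t = x - 6 >= 0 the difference of the two sides is visibly nonnegative. *)
have -> : x = (x - 6) + 6 by ring.
have : 0 <= x - 6 by lra.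
move: (x - 6) => t t0.
rewrite -subr_ge0 [leRHS](_ : _ = 11 * (t + 11) * (3 * (t + 6) ^+ 4 + 16 * (t + 6) ^+ 3
  + 21 * (t + 6) ^+ 2 + 60 * (t + 6) + 25)); last by ring.
rewrite !(mulr_ge0, addr_ge0, exprn_ge0) //.
Qed.

(** Round n up to a multiple of 6, at most n + 6: 11 (n + 5) <= 12 n exactly when n >= 55. *)
Lemma mertens_prod_le (R : realFieldType) (n : nat) : (55 <= n)%N ->
  mertens_prod R n ^+ 3 <= 12 * n%:R.
Proof.
move=> n55; set k := (n %/ 6).+1.
have k1 : (n <= 6 * k)%N by rewrite /k; lia.
have k2 : (6 * k <= n + 6)%N by rewrite /k; lia.
apply: (@le_trans _ _ (mertens_prod R (6 * k) ^+ 3)).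
  by rewrite ler_pXn2r ?nnegrE ?mertens_prod_ge0 // mertens_prod_homo // k1 andbT; lia.
apply: (le_trans (mertens_prod6_le R _)) => //.
have : (6 * k)%:R <= n%:R + 6 :> R by rewrite -natrD ler_nat.
have : 55 <= n%:R :> R by rewrite ler_nat.
lra.
Qed.

(** * Cube roots and the tail of the sum over large primes *)

Definition cbrt (R : realType) (n : nat) : R := n%:R `^ (3^-1).

Lemma cbrtK (R : realType) (n : nat) : cbrt R n ^+ 3 = n%:R.
Proof. by rewrite /cbrt -powR_mulrn ?powR_ge0 // -powRrM mulVf // powRr1. Qed.

Lemma cbrt_gt0 (R : realType) (n : nat) : (0 < n)%N -> 0 < cbrt R n.
Proof. by move=> n0; rewrite /cbrt powR_gt0 // ltr0n. Qed.

(** For the cube roots x <= y of n and n + 1, (y - x) (x^2 + x y + y^2) = 1, so 1/x - 1/y = 1 / (x y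
    (x^2 + x y + y^2)) >= 1 / (3 y^4). *)
Lemma cbrt_telescope (R : realType) (n : nat) : (0 < n)%N ->
  (cbrt R n.+1 ^+ 4)^-1 <= 3 * ((cbrt R n)^-1 - (cbrt R n.+1)^-1).
Proof.
move=> n0; have x0 := cbrt_gt0 R n0; have y0 := cbrt_gt0 R (ltn0Sn n).
have := cbrtK R n; have := cbrtK R n.+1; rewrite -natr1.
move: (cbrt R n) (cbrt R n.+1) x0 y0 => x y x0 y0 hy hx.
have xy : x <= y.
  have h3 : x ^+ 3 <= y ^+ 3 by lra.
  by rewrite -(@ler_pXn2r _ 3) ?nnegrE ?(ltW x0) ?(ltW y0).
have e : (y - x) * (x ^+ 2 + x * y + y ^+ 2) = 1.
  by rewrite (_ : _ * _ = y ^+ 3 - x ^+ 3); [rewrite hy hx; ring|ring].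
have q0 : 0 < x ^+ 2 + x * y + y ^+ 2 by nra.
have -> : 3 * (x^-1 - y^-1) = 3 * ((y - x) / (x * y)).
  by field; rewrite !gt_eqF.
rewrite (_ : y - x = (x ^+ 2 + x * y + y ^+ 2)^-1); last first.
  by apply: (mulIf (lt0r_neq0 q0)); rewrite e mulVf ?lt0r_neq0.
have -> : 3 * ((x ^+ 2 + x * y + y ^+ 2)^-1 / (x * y)) = 3 / ((x ^+ 2 + x * y + y ^+ 2) *
  (x * y)).
  by field; rewrite !gt_eqF.
rewrite ler_pdivlMr ?mulr_gt0 // mulrC ler_pdivrMr ?exprn_gt0 //.
have xy2 : x ^+ 2 + x * y + y ^+ 2 <= 3 * y ^+ 2 by nra.
have xy3 : x * y <= y ^+ 2 by nra.
rewrite (_ : 3 * y ^+ 4 = (3 * y ^+ 2) * y ^+ 2); last by ring.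
by apply: ler_pM => //; [exact: ltW|rewrite ltW // mulr_gt0].
Qed.

Lemma sum_inv_cbrt4_le (R : realType) (Y N : nat) : (0 < Y)%N ->
  \sum_(Y.+1 <= n < N) (cbrt R n ^+ 4)^-1 <= 3 / cbrt R Y.
Proof.
move=> Y0; have [NY|YN] := leqP N Y.+1.
  by rewrite big_geq // divr_ge0 // ltW // cbrt_gt0.
case: N YN => // N YN; rewrite big_add1 /=.
apply: (@le_trans _ _ (\sum_(Y <= n < N) (- (3 / cbrt R n.+1) - - (3 / cbrt R n)))).
  rewrite big_nat_cond [leRHS]big_nat_cond; apply: ler_sum => n /andP[/andP[Yn _] _].
  by have := cbrt_telescope R (leq_trans Y0 Yn); lra.
rewrite telescope_sumr; last by rewrite -ltnS ltnW.
rewrite opprK addrC gerDl oppr_le0 divr_ge0 // ltW // cbrt_gt0 //.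
by apply: leq_trans Y0 _; rewrite -ltnS ltnW.
Qed.

(** As 12 < 2.3^3 and 2.3^2 < 16/3, each term is at most (16/3) p^(-4/3), and these have tail at
    most 3 Y^(-1/3) before the factor 16/3. *)
Lemma sum_mertens_prod_le (R : realType) (Y N : nat) : (55 <= Y)%N ->
  \sum_(Y.+1 <= p < N) mertens_prod R p ^+ 2 / p%:R ^+ 2 <= 16 / cbrt R Y.
Proof.
move=> Y55; have Y0 : (0 < Y)%N by apply: leq_trans Y55.
have h : (16 / 3) * (3 / cbrt R Y) = 16 / cbrt R Y by field; rewrite gt_eqF // cbrt_gt0.
rewrite -h; apply: (le_trans _ (ler_wpM2l _ (sum_inv_cbrt4_le R N Y0))); last by lra.
rewrite mulr_sumr big_nat_cond [leRHS]big_nat_cond;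
  apply: ler_sum => n /andP[/andP[Yn _] _].
have n0 : (0 < n)%N by apply: leq_trans Yn.
have y0 := cbrt_gt0 R n0; have H0 := mertens_prod_ge0 R n.
have := @mertens_prod_le R n (leq_trans Y55 (ltnW Yn)); rewrite -(cbrtK R n).
move: (cbrt R n) (mertens_prod R n) y0 H0 => y H y0 H0 hH.
have Hy : H <= 23 / 10 * y.
  rewrite -(@ler_pXn2r _ 3) ?nnegrE ?mulr_ge0 ?(ltW y0) //.
  apply: (le_trans hH); rewrite exprMn ler_wpM2r ?exprn_ge0 ?(ltW y0) //; lra.
have H2 : H ^+ 2 <= 16 / 3 * y ^+ 2 by nra.
rewrite -[leLHS]mulrC ler_pdivrMl ?exprn_gt0 //; apply: (le_trans H2).
by rewrite le_eqVlt; apply/orP; left; apply/eqP; field; rewrite gt_eqF.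
Qed.

(** * Mean square of the error terms *)

(* The square of the coefficient of phi in the bound for the measure of resonant phi q,
   with p the largest prime factor of q; Y is the threshold below which p is not
   removed from the modulus. *)
Definition err_sqr (R : realType) (Y q : nat) : R :=
  let p := max_pdiv q in
  if (Y < p)%N && ~~ (p ^ 2 %| q)%N
  then 676 * (size (divisors (q %/ p)))%:R / (p * q)%:R
  else 196 * (size (divisors q))%:R / q%:R.

Lemma err_sqr_ge0 (R : realType) (Y q : nat) : 0 <= err_sqr R Y q.
Proof. by rewrite /err_sqr; case: ifP => _; apply: divr_ge0 (mulr_ge0 _ _) _;
  exact: ler0n. Qed.

Lemma size_divisors_gt0 (n : nat) : (0 < n)%N -> (0 < size (divisors n))%N.
Proof. by move=> n0; rewrite -has_predT; apply/hasP; exists n => //;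
  rewrite divisors_id. Qed.

(** The left side is the number of intervals of [resonant] times their length 2 phi / q; the
    successor accounts for a = q. *)
Lemma sqr_count_err_le (R : realType) (phi : R) (Y q : nat) :
  0 < phi -> (0 < Y)%N -> (0 < q)%N ->
  (sqr_count (3 * phi) q).+1%:R * (2 * phi / q%:R) <=
  48 * pi * phi ^+ 2 + phi * Num.sqrt (err_sqr R Y q).
Proof.
move=> f0 Y0 q0; have qR : 0 < q%:R :> R by rewrite ltr0n.
have b0 : 0 < 3 * phi by rewrite mulr_gt0.
have p3 := @pi_ge3 R.
(* Both branches of [err_sqr] fit this scheme, with s^2 = 2 n tau(n) and n = q / p or n = q. As n
   tau(n) >= 1, the constants 676 = 4 * 13^2 and 196 = 4 * 7^2 suffice: 8 sqrt 2 + 1 <= 13 and 4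
   sqrt 2 + 1 <= 7. *)
have gen (c d e2 s : R) : 0 <= s -> 2 <= s ^+ 2 -> 0 <= c -> 0 <= d -> c <= 24 * pi
  -> 0 <= e2 ->
    (sqr_count (3 * phi) q)%:R <= c * phi * q%:R + d * s ->
    4 * (d * s + 1) ^+ 2 <= e2 * q%:R ^+ 2 ->
    (sqr_count (3 * phi) q).+1%:R * (2 * phi / q%:R) <= 48 * pi * phi ^+ 2 + phi
      * Num.sqrt e2.
  move=> s0 s2 c0 d0 c24 e0 hN he.
  have hs : 2 * (d * s + 1) <= Num.sqrt e2 * q%:R.
    have ds0 : 0 <= d * s by exact: mulr_ge0.
    have lhs0 : 0 <= 2 * (d * s + 1) by lra.
    have rhs0 : 0 <= Num.sqrt e2 * q%:R by rewrite mulr_ge0 ?sqrtr_ge0.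
    rewrite -(@ler_pXn2r _ 2) ?nnegrE //.
    by rewrite exprMn exprMn sqr_sqrtr //; lra.
  rewrite mulrA ler_pdivrMr // -natr1.
  set Nq := _%:R in hN *; set S := Num.sqrt e2 in hs *.
  apply: (@le_trans _ _ ((c * phi * q%:R + d * s + 1) * (2 * phi))).
    by rewrite ler_wpM2r ?mulr_ge0 ?(ltW f0) //; lra.
  have h1 : c * (phi ^+ 2 * q%:R) <= 24 * pi * (phi ^+ 2 * q%:R).
    by rewrite ler_wpM2r // mulr_ge0 ?sqr_ge0 ?ltW.
  have h2 : phi * (2 * (d * s + 1)) <= phi * (S * q%:R) by rewrite ler_wpM2l // ltW.
  lra.
have sP n : (0 < n)%N -> let s := Num.sqrt (2 * (n * size (divisors n))%:R) : R in
    [/\ 0 <= s, 2 <= s ^+ 2, 1 <= s & s ^+ 2 = 2 * (n%:R * (size (divisors n))%:R)].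
  move=> n0 s; have s2 : s ^+ 2 = 2 * (n * size (divisors n))%:R.
    by rewrite sqr_sqrtr // mulr_ge0.
  have : 1 <= (n * size (divisors n))%:R :> R.
    by rewrite ler1n muln_gt0 n0 size_divisors_gt0.
  have := sqrtr_ge0 (2 * (n * size (divisors n))%:R : R); rewrite -/s => s0 h.
  split=> //; [lra| |by rewrite s2 natrM].
  nra.
have := err_sqr_ge0 R Y q; rewrite /err_sqr.
case: ifP => [/andP[Yp p2q]|_] e0.
  have q1 : (1 < q)%N by case: q {qR e0 gen p2q} q0 Yp => [|[|]] // _; rewrite ltnNge Y0.
  have pp := max_pdiv_prime q1; set p := max_pdiv q in Yp p2q pp e0 *.
  have qE : q = (p * (q %/ p))%N by rewrite mulnC divnK // max_pdiv_dvd.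
  set m := (q %/ p)%N in qE e0 *.
  have m0 : (0 < m)%N by move: q0; rewrite qE muln_gt0 => /andP[].
  have cpm : coprime p m.
    rewrite prime_coprime //; apply: contra p2q => pm.
    by rewrite qE -mulnn dvdn_mul.
  have [s0 s2 s1 sE] := sP _ m0.
  have hN := sqr_count_mul_prime_le_sqrt b0 pp cpm m0; rewrite -qE in hN.
  apply: (gen (24 * pi) 8 _ _ s0 s2) => //; [by rewrite mulr_ge0 ?pi_ge0|lra|].
  have pR : 0 < p%:R :> R by rewrite ltr0n prime_gt0.
  have -> : 676 * (size (divisors m))%:R / (p * q)%:R * q%:R ^+ 2 = 338 * (2 * (m%:R *
    (size (divisors m))%:R)) :> R.
    rewrite natrM (_ : q%:R = p%:R * m%:R :> R); last by rewrite -natrM -qE.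
    by field; rewrite !gt_eqF // ltr0n.
  rewrite -sE; nra.
have [s0 s2 s1 sE] := sP _ q0.
have hN := sqr_count_le b0 q0.
apply: (gen (12 * pi) 4 _ _ s0 s2) => //; [by rewrite mulr_ge0 ?pi_ge0|lra|lra|].
have -> : 196 * (size (divisors q))%:R / q%:R * q%:R ^+ 2 = 98 * (2 * (q%:R * (size
  (divisors q))%:R)) :> R.
  by field; rewrite gt_eqF.
rewrite -sE; nra.
Qed.

Lemma sum_smooth_tau_le (R : realType) (n N : nat) : (0 < n)%N ->
  \sum_(1 <= m < N | (max_pdiv m <= n)%N) (size (divisors m))%:R / m%:R <=
  mertens_prod R n ^+ 2.
Proof.
move=> n0; apply: (@sum_smooth_divisors_le R (fun m => m%:R^-1)) => //.
- exact: invr1.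
- by move=> k l; rewrite natrM invfM.
- by move=> p /prime_gt1 p1; rewrite invf_lt1 ?ltr1n ?ltr0n // ltnW.
Qed.

(** Sort q by its largest prime p and write q = p m, or q = p^2 m if p^2 | q, with m p-smooth. The
    terms are at most 676 tau(m) / (p^2 m) and, as tau(q) <= 4 tau(m), 784 tau(m) / (p^2 m). Summing
    over m gives the squared Mertens product, and 676 + 784 = 1460. *)
Lemma sum_err_sqr_rough_le (R : realType) (Y N : nat) : (55 <= Y)%N ->
  \sum_(1 <= q < N | (Y < max_pdiv q)%N) err_sqr R Y q <= 1460 * (16 / cbrt R Y).
Proof.
move=> Y55; have Y0 : (0 < Y)%N by exact: leq_trans Y55.
pose G m : R := (size (divisors m))%:R / m%:R.
have G0 m : 0 <= G m by rewrite divr_ge0.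
have cG0 (k p m : nat) : 0 <= k%:R / p%:R ^+ 2 * G m.
  by apply: mulr_ge0 (G0 m); apply: divr_ge0; [exact: ler0n|exact: sqr_ge0].
apply: (@le_trans _ _ (\sum_(1 <= q < N) \sum_(Y.+1 <= p < N)
  ((if (p %| q)%N && (max_pdiv q <= p)%N then 676 / p%:R ^+ 2 * G (q %/ p)%N else 0) +
   (if (p ^ 2 %| q)%N && (max_pdiv q <= p)%N then 784 / p%:R ^+ 2 * G
     (q %/ p ^ 2)%N else 0)))).
  rewrite big_mkcond /= big_nat_cond [leRHS]big_nat_cond;
    apply: ler_sum => q /andP[/andP[q0 qN] _].
  have T0 p : 0 <= ((if (p %| q)%N && (max_pdiv q <= p)%N then 676 / p%:R ^+ 2 * G
    (q %/ p)%N else 0) +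
   (if (p ^ 2 %| q)%N && (max_pdiv q <= p)%N then 784 / p%:R ^+ 2 * G
     (q %/ p ^ 2)%N else 0)) :> R.
    by apply: addr_ge0; case: ifP => _; do ?exact: cG0; exact: lexx.
  case: ifP => Yp; last by apply: sumr_ge0 => p _; exact: T0.
  have q1 : (1 < q)%N by case: q {qN T0} q0 Yp => [|[|]] // _; rewrite ltnNge Y0.
  have pp := max_pdiv_prime q1; have pq := max_pdiv_dvd q.
  rewrite (big_rem (max_pdiv q)) /=; last first.
    by rewrite mem_index_iota Yp /= (leq_ltn_trans _ qN) // dvdn_leq.
  have : err_sqr R Y q <= (if (max_pdiv q %| q)%N &&
    (max_pdiv q <= max_pdiv q)%N then 676 / (max_pdiv q)%:R ^+ 2 * G
      (q %/ max_pdiv q)%N else 0) +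
   (if (max_pdiv q ^ 2 %| q)%N && (max_pdiv q <= max_pdiv q)%N then 784 /
     (max_pdiv q)%:R ^+ 2 * G (q %/ max_pdiv q ^ 2)%N else 0).
    rewrite leqnn pq /= andbT /err_sqr Yp /=.
    set p := max_pdiv q in pp pq *; have pR : 0 < p%:R :> R by rewrite ltr0n prime_gt0.
    have [p2q|p2q] := boolP (p ^ 2 %| q)%N => /=.
      apply: ler_wpDl; first exact: cG0.
      set m := (q %/ p ^ 2)%N.
      have qE : q = (p * (p * m))%N by rewrite mulnA mulnn mulnC divnK.
      have m0 : (0 < m)%N by move: q0; rewrite qE !muln_gt0 => /and3P[].
      have tau4 : (size (divisors q))%:R <= 4 * (size (divisors m))%:R :> R.
        have pm0 : (0 < p * m)%N by rewrite muln_gt0 prime_gt0.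
        have h1 := size_divisors_mul_prime pp m0.
        have := leq_trans (size_divisors_mul_prime pp pm0) (leq_mul (leqnn 2) h1).
        by rewrite (mulnA 2%N 2%N) -qE -(ler_nat R) natrM.
      have mR : 0 < m%:R :> R by rewrite ltr0n.
      rewrite [leRHS](_ : _ = 196 * (4 * (size (divisors m))%:R) / q%:R).
        by apply: ler_wpM2r; [rewrite invr_ge0; exact: ler0n|apply: ler_wpM2l tau4;
          exact: ler0n].
      by rewrite /G qE !natrM; field; rewrite !gt_eqF.
    rewrite addr0 /G; set m := (q %/ p)%N.
    have qE : q = (p * m)%N by rewrite mulnC divnK.
    have mR : 0 < m%:R :> R by rewrite ltr0n; move: q0; rewrite qE muln_gt0 => /andP[].
    by rewrite le_eqVlt; apply/orP; left; apply/eqP; rewrite qE !natrM; field;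
      rewrite !gt_eqF.
  by move=> /le_trans; apply; rewrite lerDl; apply: sumr_ge0 => p _; exact: T0.
rewrite exchange_big_nat /=.
have HY := sum_mertens_prod_le R N Y55.
apply: (@le_trans _ _ (1460 * (\sum_(Y.+1 <= p < N) mertens_prod R p ^+ 2 / p%:R ^+ 2)));
  last first.
  by apply: ler_wpM2l HY; exact: ler0n.
rewrite mulr_sumr big_nat_cond [leRHS]big_nat_cond;
  apply: ler_sum => p /andP[/andP[Yp _] _].
have p0 : (0 < p)%N by exact: leq_trans Yp.
have pR : 0 < p%:R :> R by rewrite ltr0n.
rewrite big_split /= -!big_mkcond /=.
have part (c : R) d : 0 <= c -> (0 < d)%N ->
    \sum_(1 <= q < N | (d %| q)%N && (max_pdiv q <= p)%N) c / p%:R ^+ 2 * G (q %/ d)%N <=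
    c / p%:R ^+ 2 * mertens_prod R p ^+ 2.
  move=> c0 d0; have cp : 0 <= c / p%:R ^+ 2 by rewrite divr_ge0 // exprn_ge0.
  have := @sum_multiples_le _ d N (fun m => (max_pdiv m <= p)%N) (fun m =>
    c / p%:R ^+ 2 * G m) d0.
  move=> /(_ (fun m => mulr_ge0 cp (G0 m))) /le_trans; apply.
  rewrite -mulr_sumr ler_wpM2l //; apply: le_trans (sum_smooth_tau_le R N p0).
  rewrite big_mkcond [leRHS]big_mkcond /= big_nat_cond [leRHS]big_nat_cond.
  apply: ler_sum => m /andP[/andP[m1 _] _]; case: ifP => h; last by case: ifP.
  by rewrite (@max_pdiv_leq_dvd p m (d * m)) ?muln_gt0 ?d0 ?dvdn_mull.
have p20 : (0 < p ^ 2)%N by rewrite expn_gt0 p0.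
apply: (le_trans (lerD (part 676 p (ler0n _ _) p0) (part 784 (p ^ 2)%N (ler0n _ _) p20))).
by rewrite le_eqVlt; apply/orP; left; apply/eqP; field; rewrite gt_eqF.
Qed.

(** For g m = 1 / sqrt m, sqrt m >= 4/3 bounds every Euler factor by 4; taking this factor for all
    integers up to n gives (4^n)^2. *)
Lemma sum_smooth_tau_sqrt_le (R : realType) (n N : nat) : (0 < n)%N ->
  \sum_(1 <= m < N | (max_pdiv m <= n)%N) (size (divisors m))%:R / Num.sqrt m%:R <=
  16 ^+ n :> R.
Proof.
move=> n0.
have sq2 (m : nat) : (1 < m)%N -> (Num.sqrt m%:R)^-1 <= 3 / 4 :> R.
  move=> m1; have s1 : 4 / 3 <= Num.sqrt m%:R :> R.
    rewrite -[leLHS]ger0_norm; last by lra.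
    rewrite -sqrtr_sqr ler_sqrt //.
    have : 2 <= m%:R :> R by rewrite ler_nat.
    lra.
  by rewrite -[leRHS]invrK lef_pV2 ?posrE; [lra|lra|lra].
have := @sum_smooth_divisors_le R (fun m => (Num.sqrt m%:R)^-1) _ _ _ _ n N n0.
move=> /(_ _ _ _ _) h; apply: (le_trans (h _ _ _ _)).
- by move=> m; rewrite invr_ge0 sqrtr_ge0.
- by rewrite sqrtr1 invr1.
- by move=> k l; rewrite natrM sqrtrM // invfM.
- by move=> p /prime_gt1/sq2; lra.
rewrite (_ : 16 ^+ n = (4 ^+ n) ^+ 2 :> R); last by rewrite -exprM mulnC exprM;
  congr (_ ^+ n); ring.
rewrite ler_pXn2r ?nnegrE ?exprn_ge0 //; last first.
  by apply: prodr_ge0 => p /prime_gt1/sq2 hp; rewrite invr_ge0; lra.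
rewrite [leRHS](_ : _ = \prod_(1 <= p < n.+1) 4); last by rewrite prodr_const_nat subn1.
rewrite big_mkcond; apply: ler_prod => p _; case: ifP => [/prime_gt1/sq2 hp|_].
  have ? : 1 / 4 <= 1 - (Num.sqrt p%:R)^-1 :> R by lra.
  rewrite invr_ge0; apply/andP; split; first by lra.
  by rewrite -[leRHS]invrK lef_pV2 ?posrE; lra.
by apply/andP; split; lra.
Qed.

Lemma sum_err_sqr_smooth_le (R : realType) (Y N : nat) (E : R) : (0 < Y)%N ->
  16 * Y%:R <= E ->
  \sum_(1 <= q < N | (max_pdiv q <= Y)%N && (expR E < q%:R)) err_sqr R Y q <=
  196 / (1 + 4 * Y%:R).
Proof.
move=> Y0 YE.
(* Rankin's trick: 1 / q <= expR (- (E / 2)) / sqrt q for q > expR E. *)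
apply: (@le_trans _ _ (\sum_(1 <= q < N | (max_pdiv q <= Y)%N)
   196 * expR (- (E / 2)) * ((size (divisors q))%:R / Num.sqrt q%:R))).
  rewrite big_mkcond [leRHS]big_mkcond /= big_nat_cond [leRHS]big_nat_cond.
  apply: ler_sum => q /andP[/andP[q0 _] _].
  have r0 : 0 <= 196 * expR (- (E / 2)) * ((size (divisors q))%:R / Num.sqrt q%:R).
    apply: mulr_ge0; first by apply: mulr_ge0; [exact: ler0n|exact: expR_ge0].
    by apply: divr_ge0; [exact: ler0n|exact: sqrtr_ge0].
  case: ifP => [/andP[qY qE]|_]; last by case: ifP => _; [exact: r0|exact: lexx].
  rewrite qY /err_sqr ltnNge qY /=.
  have qR : 0 < q%:R :> R by rewrite ltr0n.
  have s0 : 0 < Num.sqrt q%:R :> R by rewrite sqrtr_gt0.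
  have sE : Num.sqrt q%:R ^+ 2 = q%:R :> R by rewrite sqr_sqrtr // ltW.
  have le : (Num.sqrt q%:R)^-1 <= expR (- (E / 2)) :> R.
    rewrite expRN lef_pV2 ?posrE ?expR_gt0 //.
    rewrite -(@ler_pXn2r _ 2) ?nnegrE ?expR_ge0 ?sqrtr_ge0 // sE -expRM_natl.
    by apply: ltW; rewrite (_ : 2 * (E / 2) = E) //; field.
  rewrite -[X in _ / X]sE expr2 invfM -!mulrA; apply: ler_wpM2l; first exact: ler0n.
  rewrite [leLHS]mulrA [leLHS]mulrC; apply: ler_wpM2r; last exact: le.
  by apply: divr_ge0; [exact: ler0n|exact: sqrtr_ge0].
rewrite -mulr_sumr.
have e2 : 2 <= expR 1 :> R by have := @expR_ge1Dx R 1; lra.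
have e16 : 16 ^+ Y <= expR (4 * Y%:R) :> R.
  have e4 : 16 <= expR 4 :> R.
    rewrite (_ : expR 4 = expR 1 ^+ 4); last by rewrite -expRM_natl mulr1.
    have e2' : 4 <= expR 1 ^+ 2 :> R by nra.
    rewrite (_ : expR 1 ^+ 4 = expR 1 ^+ 2 * expR 1 ^+ 2); last by ring.
    nra.
  rewrite [4 * _]mulrC expRM_natl; apply: lerXn2r e4; rewrite nnegrE.
    exact: ler0n.
  exact: expR_ge0.
have h := sum_smooth_tau_sqrt_le R N Y0.
apply: (@le_trans _ _ (196 * expR (- (E / 2)) * expR (4 * Y%:R))).
  apply: ler_wpM2l; last exact: le_trans h e16.
  by apply: mulr_ge0; [exact: ler0n|exact: expR_ge0].
rewrite -mulrA -expRD; apply: ler_wpM2l; first exact: ler0n.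
(* By 16 Y <= E, the exponent 4 Y - E / 2 is at most -4 Y. *)
apply: (@le_trans _ _ (expR (- (4 * Y%:R)))); first by rewrite ler_expR; lra.
rewrite expRN lef_pV2 ?posrE ?expR_gt0 ?expR_ge1Dx //.
Qed.

(** From e >= (7/6)^6 >= 5/2 one gets e^4 >= 2^5, and 41 = 4 * 10 + 1. The exponent 49 serves 16 Y
    <= e^41 with Y = 2^45. *)
Lemma exp41_ge (R : realType) : 2 ^+ 49 <= expR 41 :> R.
Proof.
have e1 : 5 / 2 <= expR 1 :> R.
  have := @expR_ge1Dx R (1 / 6); set x := expR _ => hx.
  have -> : expR 1 = x ^+ 6 :> R by rewrite -expRM_natl; congr expR; field.
  have h2 : 136 / 100 <= x ^+ 2 by nra.
  rewrite (_ : x ^+ 6 = x ^+ 2 * x ^+ 2 * x ^+ 2); last by ring.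
  have h4 : 184 / 100 <= x ^+ 2 * x ^+ 2 by nra.
  nra.
rewrite (_ : expR 41 = expR 1 ^+ 41 :> R); last by rewrite -expRM_natl mulr1.
have e4 : 2 ^+ 5 <= expR 1 ^+ 4 :> R.
  have h2 : 6 <= expR 1 ^+ 2 :> R by nra.
  rewrite (_ : expR 1 ^+ 4 = expR 1 ^+ 2 * expR 1 ^+ 2); last by ring.
  nra.
have e40 : (2 ^+ 5) ^+ 10 <= (expR 1 ^+ 4) ^+ 10 :> R.
  by rewrite ler_pXn2r ?nnegrE ?exprn_ge0 ?expR_ge0.
rewrite -!exprM in e40.
rewrite [leRHS]exprS; apply: (@le_trans _ _ (1 * 2 ^+ (5 * 10))).
  by rewrite mul1r; apply: ler_eXn2l; lra.
apply: ler_pM e40; [exact: ler01|by rewrite exprn_ge0|lra].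
Qed.

Lemma sum_err_sqr_le1 (R : realType) : exists Y : nat, (0 < Y)%N /\
  forall N : nat,
  \sum_(1 <= q < N | expR (expR 41) < q%:R :> R) err_sqr R Y q <= 1.
Proof.
(* Y = 2^45 has cube root 2^15, so the rough part is at most 1460 * 16 / 2^15 < 3/4. Only the real
   value of Y is kept, lest a huge unary numeral be unfolded. *)
have [Y YE] : exists Y : nat, Y%:R = 2 ^+ 45 :> R by exists (2 ^ 45)%N; rewrite natrX.
have Y64 : 2 ^+ 10 <= Y%:R :> R by rewrite YE; apply: ler_weXn2l => //; lra.
have Y55 : (55 <= Y)%N by rewrite -(ler_nat R); lra.
have Y0 : (0 < Y)%N by exact: leq_trans Y55.
have cY : 2 ^+ 15 <= cbrt R Y.
  by rewrite -(@ler_pXn2r _ 3) ?nnegrE ?exprn_ge0 ?(ltW (cbrt_gt0 R Y0)) // cbrtK YE -exprM.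
exists Y; split=> // N.
have h1 := sum_err_sqr_rough_le R N Y55.
have YE16 : 16 * Y%:R <= expR 41 :> R.
  apply: le_trans (exp41_ge R); rewrite YE (_ : 16 = 2 ^+ 4) -?exprD //; ring.
have h2 := sum_err_sqr_smooth_le N Y0 YE16.
have h3 : 1460 * (16 / cbrt R Y) <= 3 / 4 :> R.
  rewrite mulrA ler_pdivrMr ?cbrt_gt0 //.
  have : (2 ^+ 15 = 8 * 2 ^+ 12 :> R) by ring.
  lra.
have h4 : 196 / (1 + 4 * Y%:R) <= 1 / 4 :> R.
  have ? : 0 <= Y%:R :> R by [].
  rewrite ler_pdivrMr; lra.
apply: (@le_trans _ _ (3 / 4 + 1 / 4)); last by lra.
apply: (le_trans _ (lerD (le_trans h1 h3) (le_trans h2 h4))).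
rewrite big_mkcond [X in _ <= X + _]big_mkcond [X in _ <= _ + X]big_mkcond -big_split /=.
apply: ler_sum => q _; have e0 := err_sqr_ge0 R Y q; rewrite ltnNge.
by case: (max_pdiv q <= Y)%N; case: (expR _ < _) => /=; rewrite ?addr0 ?add0r.
Qed.

(** * The measure of the exceptional set *)

(** The first term is 1. As [zeta] is a [limn], convergence has to come first: 112/57 >= 4/3, and
    the sum of q^(-4/3) over q >= 2 is at most 3. *)
Lemma zeta_ge1 (R : realType) : 1 <= zeta (112 / 57) :> R.
Proof.
pose u (n : nat) : R := \sum_(1 <= q < n) q%:R `^ (- (112 / 57)).
have u2 : u 2%N = 1 by rewrite /u big_nat1 powR1.
have u_nd : {homo u : n m / (n <= m)%N >-> n <= m}.
  apply/nondecreasing_seqP => -[|n]; first by rewrite /u !big_geq.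
  by rewrite /u [leRHS]big_nat_recr //= lerDl powR_ge0.
have le (q : nat) : (0 < q)%N -> q%:R `^ (- (112 / 57)) <= (cbrt R q ^+ 4)^-1.
  move=> q0; rewrite /cbrt -powR_mulrn ?powR_ge0 // -powRrM -powRN.
  by apply: ler_powR; [rewrite ler1n|lra].
have ub n : u n <= 4.
  have [n2|n2] := leqP n 2; first by apply: (le_trans (u_nd _ _ n2)); rewrite u2; lra.
  rewrite /u big_ltn ?(ltnW n2) // powR1.
  have := sum_inv_cbrt4_le R n (isT : (0 < 1)%N).
  rewrite {2}/cbrt powR1 divr1 => h.
  have : \sum_(2 <= q < n) q%:R `^ (- (112 / 57)) <= \sum_(2 <= q < n) (cbrt R q ^+ 4)^-1.
    rewrite big_nat_cond [leRHS]big_nat_cond; apply: ler_sum => q /andP[/andP[q2 _] _].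
    by apply: le; exact: ltnW.
  lra.
have cvu : cvgn u by apply: nondecreasing_is_cvgn => //; exists 4 => _ [n _ <-].
by have := nondecreasing_cvgn_le u_nd cvu 2; rewrite u2.
Qed.

(** The infimum is attained at the floor of y + 1/2, so even the non-strict inequality has an
    integer witness. *)
Lemma dist_int_le_near (R : realType) (c y : R) : (dist_int y <= c) = near_int c y.
Proof.
pose m := Num.floor (y + 2^-1).
have /andP[m1 m2] : m%:~R <= y + 2^-1 < (m + 1)%:~R by exact: floor_itv.
rewrite rmorphD /= in m2.
have lbm : lbound [set `|y - k%:~R| | k in [set: int]] `|y - m%:~R|.
  move=> _ [k _ <-]; have [km|mk|->//] := ltgtP k m.
    have : k%:~R + 1 <= m%:~R :> R by rewrite -(intrD _ k 1) ler_int lezD1.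
    move=> h; have -> : `|y - k%:~R| = y - k%:~R by apply: ger0_norm; lra.
    by rewrite ler_norml; apply/andP; split; lra.
  have : m%:~R + 1 <= k%:~R :> R by rewrite -(intrD _ m 1) ler_int lezD1.
  move=> h; have -> : `|y - k%:~R| = k%:~R - y by rewrite ler0_norm ?opprB //; lra.
  by rewrite ler_norml; apply/andP; split; lra.
have dE : dist_int y = `|y - m%:~R|.
  apply/eqP; rewrite eq_le; apply/andP; split.
    by apply: ge_inf; [exists (`|y - m%:~R|)|exists m].
  by apply: lb_le_inf => //; exists (`|y - m%:~R|); exists m.
apply/idP/asboolP => [|[k hk]]; first by rewrite dE => h; exists m.
by rewrite dE; apply: le_trans hk; apply: lbm; exists k.
Qed.

Lemma measurable_dist_int_le (R : realType) (f : R -> R) (c : R) : continuous f ->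
  measurable [set x | dist_int (f x) <= c].
Proof.
move=> cf; rewrite (_ : [set x | _] =
   \bigcup_(m : int) (f @^-1` `[m%:~R - c, m%:~R + c])); last first.
  apply/seteqP; split=> x /=.
    rewrite dist_int_le_near => /asboolP[m]; rewrite ler_norml => /andP[h1 h2].
    by exists m => //=; rewrite in_itv /=; apply/andP; split; lra.
  move=> [m _] /=; rewrite in_itv /= => /andP[h1 h2].
  by rewrite dist_int_le_near; apply/asboolP; exists m; rewrite ler_norml; apply/andP;
    split; lra.
apply: countable_bigcupT_measurable => [|m]; first exact: countableP.
rewrite -[X in measurable X]setTI.
exact: (measurable_realfun.continuous_measurable_fun cf).
Qed.

Lemma measurable_Bad (R : realType) (psi : nat -> R) (kappa : R) :
  measurable (Bad psi kappa).
Proof.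
pose C (q : nat) := [set x : R | dist_int (q%:R * x) <= kappa * psi q] `&`
   [set x : R | dist_int (q%:R * x ^+ 2) <= kappa * psi q].
rewrite (_ : Bad psi kappa = `[0, 1] `\` \bigcup_(q in [set q | (0 < q)%N]) C q).
  apply: measurableD => //; apply: bigcup_measurable => q _.
  apply: measurableI; apply: measurable_dist_int_le => x.
    by apply: cvgM; [exact: cvg_cst|exact: cvg_id].
  by apply: cvgM; [exact: cvg_cst|exact: exprn_continuous].
apply/seteqP; split=> x /=.
  move=> [x01 h]; split=> // -[q /= q0 [/= h1 h2]].
  by have := h q q0; rewrite lt_max ltNge h1 ltNge h2.
move=> [x01 h]; split=> // q q0; rewrite ltNge ge_max; apply/negP => /andP[h1 h2].
by apply: h; exists q.
Qed.

(** * Covering by intervals around fractions a/q *)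

Definition resonant (R : realType) (phi : R) (q : nat) : set R :=
  \big[setU/set0]_(0 <= a < q.+1 | near_int (3 * phi) ((a ^ 2)%:R / q%:R))
    `[(a%:R - phi) / q%:R, (a%:R + phi) / q%:R]%classic.

(** The integer a within phi of q x satisfies 0 <= a <= q since phi < 1. Moreover a^2 / q - q x^2 =
    (a - q x) (a + q x) / q is at most 2 phi in absolute value, which with ||q x^2|| <= phi gives 3
    phi. *)
Lemma resonant_cover (R : realType) (phi x : R) (q : nat) : (0 < q)%N ->
  phi < 1 / 6 -> 0 <= x <= 1 ->
  dist_int (q%:R * x) <= phi -> dist_int (q%:R * x ^+ 2) <= phi ->
  resonant phi q x.
Proof.
move=> q0 f6 /andP[x0 x1]; rewrite !dist_int_le_near => /asboolP[m hm] /asboolP[k hk].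
have qR : 0 < q%:R :> R by rewrite ltr0n.
have qx : q%:R * x <= q%:R by rewrite ler_piMr // ltW.
have qx0 : 0 <= q%:R * x by rewrite mulr_ge0 // ltW.
move: hm; rewrite ler_norml => /andP[hm1 hm2].
have m0 : (0 <= m)%R.
  by rewrite -ltzD1 -(ltr_int R) intrD; lra.
case: m m0 hm1 hm2 => // a _; rewrite -pmulrn => hm1 hm2.
have aq : (a <= q)%N.
  by rewrite -ltnS -(ltr_nat R) -natr1; lra.
have aR : a%:R <= q%:R :> R by rewrite ler_nat.
rewrite /resonant -bigcup_seq_cond; exists a => /=; last first.
  by rewrite in_itv /= ler_pdivrMr // ler_pdivlMr //; apply/andP; split; lra.
rewrite mem_index_iota ltnS aq /=; apply/asboolP; exists k.
have -> : (a ^ 2)%:R / q%:R - k%:~R =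
    (a%:R - q%:R * x) / q%:R * (a%:R + q%:R * x) + (q%:R * x ^+ 2 - k%:~R) :> R.
  by rewrite natrX; field; rewrite gt_eqF.
apply: (le_trans (ler_normD _ _)); rewrite [3 * _](_ : _ = phi * 2 + phi); last by ring.
apply: lerD => //; rewrite mulrAC -mulrA normrM.
have s0 : 0 <= (a%:R + q%:R * x) / q%:R by rewrite divr_ge0 ?addr_ge0 // ltW.
apply: ler_pM => //; first by rewrite ler_norml; apply/andP; split; lra.
by rewrite ger0_norm // ler_pdivrMr //; lra.
Qed.

Lemma lebesgue_measure_resonant (R : realType) (phi : R) (q : nat) :
  (0 < q)%N -> 0 <= phi ->
  (lebesgue_measure (resonant phi q) <=
   ((sqr_count (3 * phi) q).+1%:R * (2 * phi / q%:R))%:E)%E.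
Proof.
move=> q0 f0; have qR : 0 < q%:R :> R by rewrite ltr0n.
have c0 : 0 <= 2 * phi / q%:R by rewrite divr_ge0 ?mulr_ge0 // ltW.
pose I (a : nat) : set R := `[(a%:R - phi) / q%:R, (a%:R + phi) / q%:R]%classic.
have mI a : measurable (I a) by exact: measurable_itv.
have h (r : seq nat) (P : pred nat) :
    (lebesgue_measure (\big[setU/set0]_(a <- r | P a) I a) <=
     ((\sum_(a <- r | P a) 1)%N%:R * (2 * phi / q%:R))%:E)%E.
  elim: r => [|a r IH]; first by rewrite !big_nil measure0 mul0r.
  rewrite !big_cons; case: ifP => Pa //.
  rewrite natrD mulrDl mul1r EFinD.
  have mU : measurable (\big[setU/set0]_(b <- r | P b) I b) by exact: bigsetU_measurable.
  have U2 := @measureU2 _ _ _ (@lebesgue_measure R) _ _ (mI a) mU.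
  apply: (le_trans U2).
  apply: leeD => //.
  have E := lebesgue_measure_itv `[(a%:R - phi) / q%:R, (a%:R + phi) / q%:R].
  rewrite [X in (X <= _)%E]E /=; case: ifP => _; last by rewrite lee_fin.
  by rewrite -EFinB lee_fin le_eqVlt; apply/orP; left; apply/eqP; field; rewrite gt_eqF.
apply: (le_trans (h _ _)); rewrite lee_fin ler_wpM2r // ler_nat.
(* The index a = q lies outside the range of [sqr_count] and costs the extra 1. *)
rewrite big_mkcond big_nat_recr //= /sqr_count.
rewrite -[leqRHS]addn1 leq_add //; last by case: ifP.
Qed.

Lemma lebesgue_measure_resonant_err (R : realType) (phi : R) (Y q : nat) :
  (0 < Y)%N -> (0 < q)%N -> 0 <= phi ->
  (lebesgue_measure (resonant phi q) <=
   (48 * pi * phi ^+ 2 + phi * Num.sqrt (err_sqr R Y q))%:E)%E.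
Proof.
move=> Y0 q0 f0; apply: (le_trans (lebesgue_measure_resonant q0 f0)); rewrite lee_fin.
move: f0; rewrite le_eqVlt => /predU1P[<-|f0]; last exact: sqr_count_err_le.
by rewrite expr0n /= !mulr0 !mul0r !mulr0 addr0.
Qed.

(** * Summation over all moduli and conclusion *)

Lemma sum_sq_ge (R : realType) (psi : nat -> R) (n : nat) :
  cvgn (fun n : nat => \sum_(1 <= q < n) psi q ^+ 2) ->
  \sum_(1 <= q < n) psi q ^+ 2 <= sum_sq psi.
Proof.
move=> cv; apply: (@nondecreasing_cvgn_le _ (fun n => \sum_(1 <= q < n) psi q ^+ 2)) => //.
apply/nondecreasing_seqP => -[|k]; first by rewrite !big_geq.
by rewrite [leRHS]big_nat_recr //= lerDl sqr_ge0.
Qed.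

(** Cauchy-Schwarz on phi q and the root of [err_sqr]. Since phi vanishes up to Q0, only the errors
    beyond Q0 enter, and their sum is at most 1. *)
Lemma sum_resonant_bound_le (R : realType) (phi : nat -> R) (Y n : nat) (Q0 T : R) :
  (forall q, (0 < q)%N -> 0 <= phi q) ->
  (forall q, (0 < q)%N -> q%:R <= Q0 -> phi q = 0) ->
  (\sum_(1 <= q < n | Q0 < q%:R) err_sqr R Y q <= 1) ->
  \sum_(1 <= q < n) phi q ^+ 2 <= T ->
  \sum_(1 <= q < n) (48 * pi * phi q ^+ 2 + phi q * Num.sqrt (err_sqr R Y q)) <=
  48 * pi * T + Num.sqrt T.
Proof.
move=> phi0 phiQ errle phiT; rewrite big_split /= -mulr_sumr.
have T0 : 0 <= T by apply: le_trans phiT; apply: sumr_ge0 => q _; exact: sqr_ge0.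
apply: lerD; first by apply: ler_wpM2l phiT; apply: mulr_ge0; [exact: ler0n|exact: pi_ge0].
rewrite (eq_big_nat _ _ (F2 := fun q => phi q *
    (if Q0 < q%:R then Num.sqrt (err_sqr R Y q) else 0))); last first.
  by move=> q /andP[q0 _]; case: ltP => // h; rewrite phiQ // !mul0r.
set L := \sum_(_ <= _ < _) _.
have L0 : 0 <= L.
  rewrite /L big_nat_cond; apply: sumr_ge0 => q /andP[/andP[q0 _] _].
  by apply: mulr_ge0; [exact: phi0|case: ifP => _; rewrite ?sqrtr_ge0].
rewrite -(@ler_pXn2r _ 2) ?nnegrE ?sqrtr_ge0 // sqr_sqrtr //.
apply: (le_trans (sqr_sum_mul_le _ _ _)); rewrite -[leRHS]mulr1.
apply: ler_pM => //; [by apply: sumr_ge0 => q _; exact: sqr_ge0|by apply: sumr_ge0 => q _;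
  exact: sqr_ge0|].
apply: le_trans errle; rewrite [leRHS]big_mkcond; apply: ler_sum => q _.
by case: ifP => _; rewrite ?expr0n //= sqr_sqrtr // err_sqr_ge0.
Qed.

Lemma lebesgue_measure_Bad_ge (R : realType) (psi : nat -> R) (delta kappa : R) :
  (forall q : nat, (0 < q)%N -> 0 <= psi q) ->
  cvgn (fun n : nat => \sum_(1 <= q < n) psi q ^+ 2) ->
  (forall q : nat, (0 < q)%N -> q%:R <= expR (expR 41) :> R -> psi q = 0) ->
  0 <= kappa ->
  (forall q : nat, (0 < q)%N -> kappa * psi q < 1 / 6) ->
  48 * pi * (kappa ^+ 2 * sum_sq psi) + kappa * Num.sqrt (sum_sq psi) <= delta ->
  ((1 - delta)%R%:E <= lebesgue_measure (Bad psi kappa))%E.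
Proof.
move=> psi0 cv psiQ k0 k6 kd; have [Y [Y0 errY]] := sum_err_sqr_le1 R.
pose phi q := kappa * psi q.
have phi0 q : (0 < q)%N -> 0 <= phi q by move=> q0; rewrite mulr_ge0 ?psi0.
(* Index 0, which is no modulus, carries [Bad] itself, so that a single countable cover of [0, 1]
   gives 1 <= measure of [Bad] + measures of the resonant sets. *)
pose F (n : nat) : set R := if n is 0 then Bad psi kappa else resonant (phi n) n.
have mF n : measurable (F n).
  case: n => [|n]; first exact: measurable_Bad.
  by apply: bigsetU_measurable => a _; exact: measurable_itv.
have cover : `[0, 1]%classic `<=` \bigcup_n F n.
  move=> x /=; rewrite in_itv /= => x01.
  have [Bx|nB] := pselect (Bad psi kappa x); first by exists 0%N.
  have [q /= [q0 hq]] : exists q, (0 < q)%N /\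
      Num.max (dist_int (q%:R * x)) (dist_int (q%:R * x ^+ 2)) <= phi q.
    apply: contrapT => h; apply: nB; split; first by rewrite in_itv.
    move=> q q0; rewrite ltNge; apply/negP => hq; apply: h; by exists q.
  exists q => //; rewrite /F; case: q q0 hq => // q _; rewrite ge_max => /andP[h1 h2].
  by apply: resonant_cover => //; exact: k6.
have h1 := @measure_sigma_subadditive _ _ _ (@lebesgue_measure R) _ F mF
  (measurable_itv _) cover.
have l01 := lebesgue_measure_itv `[0 : R, 1].
rewrite /= lte_fin ltr01 oppr0 adde0 in l01.
have h0 : (1%:E <= lebesgue_measure (`[0%R, 1%R]%classic : set R))%E.
  by rewrite [X in (_ <= X)%E]l01.
have h2 : (\big[+%E/0]_(0 <= n <oo) lebesgue_measure (F n) <=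
    lebesgue_measure (Bad psi kappa) + delta%:E)%E.
  apply: lime_le; first exact: is_cvg_nneseries.
  near=> n; have n0 : (0 < n)%N by near: n; exact: nbhs_infty_gt.
  rewrite big_ltn //; apply: leeD => //.
  apply: (@le_trans _ _ (\sum_(1 <= q < n)
      (48 * pi * phi q ^+ 2 + phi q * Num.sqrt (err_sqr R Y q))%:E)%E).
    rewrite big_nat_cond [leRHS]big_nat_cond; apply: lee_sum => q /andP[/andP[q0 _] _].
    rewrite (_ : F q = resonant (phi q) q); last by rewrite /F; case: q q0.
    exact: lebesgue_measure_resonant_err (phi0 _ q0).
  rewrite sumEFin lee_fin; apply: le_trans kd.
  have kS : 0 <= sum_sq psi.
    by apply: le_trans (sum_sq_ge 0 cv); rewrite big_geq.
  rewrite [kappa * _](_ : _ = Num.sqrt (kappa ^+ 2 * sum_sq psi)); last first.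
    by rewrite sqrtrM ?sqr_ge0 // sqrtr_sqr ger0_norm.
  apply: (sum_resonant_bound_le phi0 _ (errY n)).
    by move=> q q0 qQ; rewrite /phi psiQ // mulr0.
  under eq_bigr do rewrite exprMn.
  by rewrite -mulr_sumr ler_wpM2l ?sqr_ge0 // sum_sq_ge.
have := le_trans (le_trans h0 h1) h2; rewrite -leeBlDr // EFinB.
Unshelve. all: by end_near. Qed.

Theorem theorem5 (R : realType) (psi : nat -> R)
    (psi_ge0 : forall q : nat, (0 < q)%N -> 0 <= psi q)
    (psi_sq_cvg : cvgn (fun n : nat => \sum_(1 <= q < n) psi q ^+ 2))
    (psi_eq0 : forall q : nat, (0 < q)%N ->
       q%:R <= expR (expR 41) :> R -> psi q = 0)
    (delta : R) (delta_gt0 : 0 < delta)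
    (kappa : R) (kappa_lt : (kappa%:E < kappa_bound psi delta)%E) :
  ((1 - delta)%R%:E <= lebesgue_measure (Bad psi kappa))%E.
Proof.
(* For kappa <= 0 the set contains [Bad psi 0], so the case kappa = 0 suffices. *)
have [k0|k0] := leP kappa 0.
  have sub : Bad psi 0 `<=` Bad psi kappa.
    move=> x [x01 h]; split=> // q q0; apply: le_lt_trans (h q q0).
    by rewrite mul0r mulr_le0_ge0 // psi_ge0.
  apply: (@le_trans _ _ (lebesgue_measure (Bad psi 0))); last first.
    by apply: le_measure => //; rewrite inE; exact: measurable_Bad.
  apply: lebesgue_measure_Bad_ge => // [q q0|]; first by rewrite mul0r; lra.
  by rewrite expr0n /= !mul0r mulr0 addr0 ltW.
have S_ge n := @sum_sq_ge R psi n psi_sq_cvg.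
have [[mx mx0 mxE] mxP] := max_val_max psi_ge0 psi_sq_cvg.
move: kappa_lt; rewrite /kappa_bound; set S := sum_sq psi in S_ge *.
rewrite !lt_min => /and4P[k1 k2 k3 _].
have S0 : 0 <= S by apply: le_trans (S_ge 0%N); rewrite big_geq.
apply: lebesgue_measure_Bad_ge => //; rewrite -?/S.
- exact: ltW.
(* If the maximum is 0, the first bound is +oo and says nothing, but then kappa psi q <= 0. *)
- move=> q q0; have [p0|p0] := leP (max_val psi) 0.
    have := mulr_ge0_le0 (ltW k0) (le_trans (mxP _ q0) p0).
    lra.
  have m6 : 0 < 6 * max_val psi by rewrite mulr_gt0.
  move: k1; rewrite inver gt_eqF // -EFinM lte_fin ltr_pdivlMr // => k1.
  have := ler_wpM2l (ltW k0) (mxP _ q0); lra.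
- have [->|Sn0] := eqVneq S 0; first by rewrite sqrtr0 !mulr0 addr0 ltW.
  have Sp : 0 < S by rewrite lt_def Sn0.
  have sS : 0 < Num.sqrt S by rewrite sqrtr_gt0.
  have p3 := @pi_ge3 R; have z1 := @zeta_ge1 R.
  (* The two terms share delta as 1/9 + 8/9. Here pi >= 3 and z >= 1 give 3 pi^2 z >= 27, and 2/27
     <= 1/9. *)
  have k2' : kappa * Num.sqrt S <= delta / 9.
    set z := Num.sqrt (pi ^+ 2 / 6 * zeta (112 / 57)) in k2.
    have z0 : 1 <= z.
      rewrite /z -[leLHS]sqrtr1 ler_sqrt; first by nra.
      by apply: mulr_ge0; [apply: divr_ge0; [exact: sqr_ge0|exact: ler0n]|lra].
    move: k2; rewrite inver gt_eqF // -!EFinM lte_fin => k2.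
    have den : 27 <= 3 * pi ^+ 2 * z.
      have : 9 <= pi ^+ 2 :> R by nra.
      nra.
    have : delta / Num.sqrt S * (2 / (3 * pi ^+ 2 * z)) <= delta / Num.sqrt S * (1 / 9).
      apply: ler_wpM2l; first by rewrite divr_ge0 ?ltW.
      rewrite ler_pdivrMr; lra.
    move=> h; have := le_trans (ltW k2) h.
    rewrite mulrAC ler_pdivlMr //; lra.
  have k3' : kappa ^+ 2 * S <= delta / (18 * pi ^+ 2).
    move: k3; rewrite inver gt_eqF // -EFinM lte_fin => k3.
    have pp : 0 < 18 * pi ^+ 2 :> R by apply: mulr_gt0;
      [rewrite ltr0n|rewrite exprn_gt0 ?pi_gt0].
    have dS : 0 <= delta / S by rewrite divr_ge0 // ltW.
    have : kappa ^+ 2 <= (Num.sqrt (delta / S) * Num.sqrt (1 / (18 * pi ^+ 2))) ^+ 2.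
      by apply: lerXn2r (ltW k3); rewrite nnegrE ?(ltW k0) // mulr_ge0 ?sqrtr_ge0.
    rewrite exprMn !sqr_sqrtr // ?divr_ge0 ?(ltW pp) // => h.
    have := ler_wpM2r S0 h; rewrite [X in _ <= X](_ : _ = delta / (18 * pi ^+ 2)) //.
    by move: (@pi_gt0 R); move: pi => P P0; field; rewrite Sn0 gt_eqF.
  have m : 48 * pi * (kappa ^+ 2 * S) <= 48 * pi * (delta / (18 * pi ^+ 2)).
    by apply: ler_wpM2l k3'; apply: mulr_ge0; [exact: ler0n|exact: pi_ge0].
  (* 48 pi / (18 pi^2) = 8 / (3 pi) <= 8/9. *)
  have m' : 48 * pi * (delta / (18 * pi ^+ 2)) <= 8 / 9 * delta.
    rewrite [leLHS](_ : _ = 8 * delta / (3 * pi)); last first.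
      by move: (@pi_gt0 R); move: pi => P P0; field; rewrite gt_eqF.
    rewrite ler_pdivrMr; last by lra.
    nra.
  lra.
Qed.
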